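(* For any $d\ge3$ and any integer $r\ge\lceil3\sqrt d\,\rceil$, there exist symmetric Borel probability measures $\mu$ on $W_r(\mathbb{Z}^d)$ such that the random walk on $\mathbb{Z}^d$ in the associated conductances $C_\mu$ is transient and such that the inverted orbits $(O_n)_{n\ge0}$ of the random walk $(\tau_n)_{n\ge0}$ on $W(\mathbb{Z}^d)$ induced by $\mu$ satisfy $$e^{-n\log(2)\,\mathbb{P}[T=\infty]+o(n)}\;\le\;\mathbb{E}\Big[\big(\tfrac12\big)^{|O_n|}\Big]\;\le\;e^{-\frac{n+1}{2}\,\mathbb{P}[T=\infty]},$$ where $\mathbb{P}[T=\infty]$ is the probability that $n\mapsto\tau_n(0)$ (a random walk in the conductances $C_\mu$ started at the origin) never returns to the origin, and $o(n)$ is as $n\to\infty$.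
   Context: $\mathfrak{S}(\mathbb{Z}^d)$ is the group of all permutations of $\mathbb{Z}^d$, with the topology of pointwise convergence. $\mathbb{Z}^d$ is viewed as the nearest-neighbour graph with graph distance $d_G$; for $\sigma\in\mathfrak{S}(\mathbb{Z}^d)$, $\mathrm{range}(\sigma)=\sup_xd_G(x,\sigma(x))$. The wobbling group is $W(\mathbb{Z}^d)=\{\sigma\in\mathfrak{S}(\mathbb{Z}^d):\mathrm{range}(\sigma)<\infty\}$, and $W_r(\mathbb{Z}^d)=\{\sigma:\mathrm{range}(\sigma)\le r\}$, a compact subset. A Borel probability measure $\mu$ (possibly diffuse) is symmetric if $\mu(A)=\mu(A^{-1})$ for every Borel set $A$, where $A^{-1}=\{\sigma:\sigma^{-1}\in A\}$. The random walk induced by $\mu$ is $\tau_0=\mathrm{Id}$, $\tau_n=s_n\circ\cdots\circ s_1$ with $(s_i)_{i\ge1}$ i.i.d. of law $\mu$. Its inverted orbit of the origin is $O_n=\bigcup_{0\le j\le n}\tau_j^{-1}(\{0\})$. The conductances associated to $\mu$ are $C_\mu(x,y):=\mu(\{\sigma:\sigma(x)=y\})+\mu(\{\sigma:\sigma(y)=x\})$, with $C_\mu(x):=\sum_yC_\mu(x,y)$; the random walk in these conductances is the Markov chain with transition probabilities $C_\mu(x,y)/C_\mu(x)$. The return time is $T=\inf\{n\ge1:\tau_n(0)=0\}$. *)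

(* Defs.v *)
From HB Require Import structures.
From mathcomp Require Import all_boot all_order all_algebra.
From mathcomp Require Import finmap.
From mathcomp Require Import all_classical all_reals all_analysis.

Set Implicit Arguments.
Unset Strict Implicit.
Unset Printing Implicit Defensive.

Import Order.TTheory GRing.Theory Num.Theory.
Import numFieldNormedType.Exports.

Local Open Scope classical_set_scope.
Local Open Scope ring_scope.

(* The inverse is carried as data; by functional extensionality and proof
   irrelevance it is determined by [pfun], so this is the set of bijections. *)
Record permutation (V : Type) := Permutation {
  pfun :> V -> V;
  pinv : V -> V;
  pfunK : cancel pfun pinv;
  pinvK : cancel pinv pfun }.

Definition perm_one (V : Type) : permutation V :=
  @Permutation V id id (fun=> erefl) (fun=> erefl).

Definition perm_inverse (V : Type) (s : permutation V) : permutation V :=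
  Permutation (pinvK s) (pfunK s).

Definition perm_comp (V : Type) (s t : permutation V) : permutation V :=
  Permutation (can_comp (pfunK s) (pfunK t)) (can_comp (pinvK t) (pinvK s)).

HB.instance Definition _ (V : Type) := gen_eqMixin (permutation V).
HB.instance Definition _ (V : Type) := gen_choiceMixin (permutation V).
HB.instance Definition _ (V : Type) :=
  isPointed.Build (permutation V) (perm_one V).

Definition pfun_ptws (V : choiceType) (s : permutation V) :
  {ptws V -> discrete_topology V} := s.

HB.instance Definition _ (V : choiceType) :=
  Topological.copy (permutation V) (initial_topology (@pfun_ptws V)).

Definition perm_borel (V : choiceType) : Type :=
  g_sigma_algebraType (@open (permutation V)).
HB.instance Definition _ (V : choiceType) := Measurable.on (perm_borel V).

Section GraphDistance.
Context (R : realType) (V : Type) (e : rel V).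

(* +oo if x and y are not connected *)
Definition graph_dist (x y : V) : \bar R :=
  ereal_inf [set ((size p)%:R)%:E | p in [set p | path e x p /\ last x p = y]].

Definition perm_range (s : permutation V) : \bar R :=
  ereal_sup [set graph_dist x (s x) | x in [set: V]].

Definition range_le (r : R) : set (permutation V) :=
  [set s | (perm_range s <= r%:E)%E].

End GraphDistance.

Notation zd d := 'rV[int]_d.

Definition zd_adj (d : nat) : rel (zd d) :=
  fun x y => \sum_(i < d) `|x 0 i - y 0 i| == 1.

Definition symmetric_law (R : realType) (V : choiceType)
    (mu : probability (perm_borel V) R) : Prop :=
  forall A : set (perm_borel V), measurable A ->
    mu A = mu [set s | A (perm_inverse s)].

Section Conductances.
Context (R : realType) (V : choiceType) (mu : probability (perm_borel V) R).
Local Open Scope ereal_scope.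

Definition conductance (x y : V) : \bar R :=
  mu [set s | s x = y] + mu [set s | s y = x].

Definition total_conductance (x : V) : \bar R :=
  \esum_(y in [set: V]) conductance x y.

Definition conductance_transition (x y : V) : R :=
  (fine (conductance x y) / fine (total_conductance x))%R.

End Conductances.

(* The one-step condition P(X_{n+1} = y | X_0 = x_0, ..., X_n = x_n) = p(x_n, y)
   is multiplied out, so that it also makes sense for null histories. *)
Definition markov_chain (R : realType) (V : Type) (p : V -> V -> R) (x : V)
    (dO : measure_display) (Om : measurableType dO) (P : probability Om R)
    (X : nat -> Om -> V) : Prop :=
  [/\ forall n (B : set V), measurable (X n @^-1` B),
      P [set w | X 0%N w = x] = 1%E
    & forall n (h : nat -> V) (y : V),
        P [set w | (forall k, (k <= n)%N -> X k w = h k) /\ X n.+1 w = y] =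
        (P [set w | forall k, (k <= n)%N -> X k w = h k] * (p (h n) y)%:E)%E].

(* Every state is transient: the chain started there returns with
   probability < 1. *)
Definition transient (R : realType) (V : Type) (p : V -> V -> R) : Prop :=
  forall (x : V) (dO : measure_display) (Om : measurableType dO)
    (P : probability Om R) (X : nat -> Om -> V),
    markov_chain p x P X ->
    (P [set w | exists2 n, (0 < n)%N & X n w = x] < 1)%E.

(* Independence is the product rule over finite subfamilies. *)
Definition iid_law (R : realType) (dO dS : measure_display)
    (Om : measurableType dO) (S : measurableType dS) (P : probability Om R)
    (mu : probability S R) (s : nat -> {mfun Om >-> S}) : Prop :=
  (forall i (A : set S), measurable A -> distribution P (s i) A = mu A) /\
  (forall (J : {fset nat}) (A : nat -> set S),
    (forall j, measurable (A j)) ->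
    P (\bigcap_(j in [set` J]) (s j @^-1` A j)) =
    (\prod_(j <- J) P (s j @^-1` A j))%E).

(* tau_n = s_n o ... o s_1, where the increments are numbered from 0:
   s_i of the formula is [s i.-1]. *)
Fixpoint walk (V : Type) (s : nat -> permutation V) (n : nat) : permutation V :=
  if n is m.+1 then perm_comp (s m) (walk s m) else perm_one V.

Definition inverted_orbit (V : Type) (x : V) (s : nat -> permutation V)
    (n : nat) : set V :=
  \bigcup_(j in [set j | (j <= n)%N]) (walk s j @^-1` [set x]).

(* +oo if the walk never returns *)
Definition return_time (R : realType) (V : Type) (x : V)
    (s : nat -> permutation V) : \bar R :=
  ereal_inf [set n%:R%:E | n in [set n | (0 < n)%N /\ walk s n x = x]].

(* Main.v *)
Require Import Defs.
From HB Require Import structures.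
From mathcomp Require Import all_boot all_order all_algebra.
From mathcomp Require Import finmap.
From mathcomp Require Import all_classical all_reals all_analysis.
From mathcomp Require Import measurable_realfun.
From mathcomp Require Import lra.

(* A step of the walk is a product of independent fair swaps of disjoint pairs
   of sites. If x and y form a pair, swapping them together leaves h(x) h(y)
   unchanged, while moving them independently gives ((h(x) + h(y)) / 2)^2,
   which is at least as large; hence E prod h(s x) <= prod E h(s x) over
   distinct points x. Killing the particles when they visit the origin, one sees
   that E (1/2)^|O_n| is at most
   prod_x (1 - P(x in O_n) / 2) <= exp (- E|O_n| / 2). On the other hand
   |O_n| counts last visits to the origin, so E|O_n| = sum_(j <= n) P(T > j),
   which is at least (n + 1) P(T = oo) and equals n P(T = oo) + o(n); Jensen's
   inequality gives the lower bound.

   The swaps only move three coordinates. The four points 0, e_0, e_1, e_2 tile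
   Z^3 along the body-centred cubic lattice, and so do their opposites. Choosing
   a uniform point in the cell of the first tiling, then of the second, then of
   the first moves a particle by at most 2 + 2 + 2 = 6 and makes the cell
   perform a random walk with steps 2(t_i - t_j), which has an explicit
   positive strict superharmonic function and is thus transient. *)

Set Implicit Arguments.
Unset Strict Implicit.
Unset Printing Implicit Defensive.

Import Order.TTheory GRing.Theory Num.Theory.
Import numFieldNormedType.Exports.

Local Open Scope classical_set_scope.
Local Open Scope ring_scope.

(** * Measurability of maps into the permutation group *)

(** The inequality for one matching survives composition because a permutation keeps distinct points
    distinct: the later factor is averaged at the moved points, and the earlier one is applied to
    the averaged function. Inversion reverses a composition, so symmetry of the law forces a
    palindromic order of the swaps. Killing turns visits into points: each particle meets the origin
    at most once, so the exponent counts distinct elements of the inverted orbit, and the killed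
    list of particles is itself a Markov chain with finitely supported steps, open to a Feynman-Kac
    recursion. For transience, |x|^(-1) is harmonic to leading order in R^3, so the sign of its
    lattice error would be delicate; |x|^(-1/2) is strictly superharmonic, with a margin that pays
    for crude Taylor estimates. *)

Lemma probability_setI1 d (T : measurableType d) (R : realType)
    (P : probability T R) (A B : set T) :
  measurable A -> measurable B -> P B = 1%E -> P (A `&` B) = P A.
Proof.
move=> mA mB PB; rewrite [RHS](measureDI P mA mB) [X in (X + _)%E](_ : _ = 0%E)
  ?add0e//.
apply/eqP; rewrite eq_le measure_ge0 andbT.
apply: (@le_trans _ _ (P (~` B))).
  by apply: le_measure; rewrite ?inE;
    [exact: measurableD|exact: measurableC|move=> x []].
by rewrite probability_setC// PB subee.
Qed.

Lemma countable_bigcup_measurable d (T : measurableType d) (I : countType)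
    (D : set I) (F : I -> set T) :
  (forall i, D i -> measurable (F i)) -> measurable (\bigcup_(i in D) F i).
Proof.
move=> mF.
pose G n := oapp (fun i => if i \in D then F i else set0) set0 (choice.unpickle
  n).
rewrite (_ : \bigcup_(i in D) F i = \bigcup_n G n).
  apply: bigcupT_measurable => n; rewrite /G.
  by case: choice.unpickle => //= i; case: ifPn => //; rewrite inE; exact: mF.
apply/seteqP; split=> w /=.
  by move=> [i Di Fw]; exists (choice.pickle i) => //;
    rewrite /G choice.pickleK /= mem_set.
move=> [n _]; rewrite /G; case: choice.unpickle => //= i; case: ifPn => //.
by rewrite inE => Di Fw; exists i.
Qed.

Lemma measurable_countable_comp d d' (T : measurableType d)
    (S : measurableType d') (W : countType) (Z : T -> W) (g : W -> S) :
  (forall z, measurable [set w | Z w = z]) ->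
  measurable_fun setT (fun w => g (Z w)).
Proof.
move=> mZ _ B mB; rewrite setTI.
rewrite (_ : _ @^-1` B = \bigcup_(z in g @^-1` B) [set w | Z w = z]).
  by apply: countable_bigcup_measurable => z _; exact: mZ.
by apply/seteqP; split=> w /=; [exists (Z w)|move=> [z zB /= ->]].
Qed.

Section PermutationBorel.
Context (V : countType).

(** The pointwise topology is a supremum of initial topologies, so convergence is tested
    coordinatewise; the filter generated by the finite cylinders at [f] therefore converges to [f]
    and contains every open neighbourhood. *)
Lemma ptws_discrete_nbhs (f : V -> V) (B : set {ptws V -> discrete_topology V})
  :
  open B -> B f ->
  exists l : seq V, forall g : V -> V, (forall x, x \in l -> g x = f x) -> B g.
Proof.
move=> oB Bf.
pose F : set_system {ptws V -> discrete_topology V} := [set A |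
  exists l : seq V, forall g : V -> V, (forall x, x \in l -> g x = f x) -> A g].
have FF : Filter F.
  split.
  - by exists [::].
  - move=> P Q [l1 h1] [l2 h2]; exists (l1 ++ l2) => g hg; split.
    + by apply: h1 => x xl; apply: hg; rewrite mem_cat xl.
    + by apply: h2 => x xl; apply: hg; rewrite mem_cat xl orbT.
  - by move=> P Q PQ [l hl]; exists l => g /hl /PQ.
suff cF : F --> (f : {ptws V -> discrete_topology V}).
  by apply: cF; exact: open_nbhs_nbhs.
apply/cvg_sup => x A.
rewrite /= (@nbhsE (initial_topology
  (fun f : V -> discrete_topology V => f x))) => -[C [[D _ <-] Cf] CA].
by exists [:: x] => g hg; apply: CA; rewrite /preimage /= hg ?mem_head.
Qed.

Lemma measurable_eval (x y : V) :
  measurable [set s : perm_borel V | s x = y].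
Proof.
apply: sub_sigma_algebra.
have oy : open ([set f | f x = y] : set {ptws V -> discrete_topology V}).
  exact: (@open_comp {ptws V -> discrete_topology V} (discrete_topology V)
    (fun f => f x) [set y] (fun g _ => @proj_continuous V _ x g)
    (discrete_open _)).
by exists [set f : {ptws V -> discrete_topology V} | f x = y].
Qed.

(** A countable [V] has only countably many finite cylinders, and every open set is the union of the
    cylinders inside it, so open sets pull back to countable unions. *)
Lemma measurable_perm_fun d (T : measurableType d) (f : T -> perm_borel V) :
  (forall x y, measurable [set w | f w x = y]) -> measurable_fun setT f.
Proof.
move=> mf.
apply: (@measurability _ _ T (perm_borel V) setT f (@open (permutation V))).
  by [].
move=> _ [U oU <-]; rewrite setTI.
pose cyl (l : seq (V * V)) : set (permutation V) :=
  [set s | forall p, p \in l -> s p.1 = p.2].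
have mcyl l : measurable (f @^-1` cyl l).
  elim: l => [|p l ih].
    by rewrite (_ : _ @^-1` _ = setT)//; apply/seteqP; split.
  rewrite (_ : _ @^-1` _ = [set w | f w p.1 = p.2] `&` f @^-1` cyl l).
    exact: measurableI.
  apply/seteqP; split=> w /=.
    by move=> h; split=> [|q ql]; apply: h; rewrite inE ?eqxx// ql orbT.
  by move=> [h1 h2] q; rewrite inE => /predU1P[->//|]; exact: h2.
have -> : f @^-1` U =
    \bigcup_(l in [set l : seq (V * V) | cyl l `<=` U]) f @^-1` cyl l.
  apply/seteqP; split=> w /=; last by move=> [l lU wl]; exact: lU.
  case: oU => B oB BU; rewrite -BU => Bw.
  have [l hl] := ptws_discrete_nbhs oB Bw.
  exists [seq (x, f w x) | x <- l]; last by move=> p /mapP[x xl ->].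
  move=> s /= hs; apply: hl => x xl.
  by apply: (hs (x, f w x)); apply: map_f.
by apply: countable_bigcup_measurable => l _; exact: mcyl.
Qed.

Lemma measurable_eval_in (x : V) (B : set V) :
  measurable [set s : perm_borel V | B (s x)].
Proof.
rewrite (_ : mkset _ = \bigcup_(y in B) [set s : perm_borel V | s x = y]).
  by apply: countable_bigcup_measurable => y _; exact: measurable_eval.
by apply/seteqP; split=> s /=; [exists (s x)|move=> [y By ->]].
Qed.

Lemma perm_eqP (s t : permutation V) : s =1 t -> s = t.
Proof.
case: s t => [f f' fK f'K] [g g' gK g'K] /= /funext fg; subst g.
have fg' : f' = g' by apply/funext => x; rewrite -[in RHS](f'K x) gK.
by subst g'; congr Permutation; exact: Prop_irrelevance.
Qed.

Lemma measurable_perm_inverse :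
  measurable_fun setT (@perm_inverse V : perm_borel V -> perm_borel V).
Proof.
apply: measurable_perm_fun => x y.
rewrite (_ : mkset _ = [set s : perm_borel V | s y = x]).
  exact: measurable_eval.
by apply/seteqP; split=> s /= h; rewrite -h;
  [exact: (Defs.pinvK s)|exact: (pfunK s)].
Qed.

Lemma measurable_perm_comp : measurable_fun setT
  (fun st : perm_borel V * perm_borel V => perm_comp st.2 st.1 : perm_borel V).
Proof.
apply: measurable_perm_fun => x y.
rewrite (_ : mkset _ = \bigcup_(z : V)
   ([set s : perm_borel V | s x = z] `*` [set t : perm_borel V | t z = y])).
  apply: countable_bigcup_measurable => z _.
  by apply: measurableX; exact: measurable_eval.
apply/seteqP; split=> [[s t] /= h|[s t] [z _ /= [<- <-]]] //.
by exists (s x).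
Qed.

Lemma measurable_map_eq (Y Z : seq V) :
  measurable [set s : perm_borel V | map s Y = Z].
Proof.
elim: Y Z => [|y Y ih] [|z Z].
- by rewrite (_ : mkset _ = setT)//; apply/seteqP; split.
- by rewrite (_ : mkset _ = set0)//; apply/seteqP; split.
- by rewrite (_ : mkset _ = set0)//; apply/seteqP; split.
rewrite (_ : mkset _ = [set s : perm_borel V | s y = z] `&` [set s | map s Y =
  Z]).
  by apply: measurableI; [exact: measurable_eval|exact: ih].
by apply/seteqP; split=> s /= [-> ->].
Qed.

Lemma measurable_map_in (Y : seq V) (B : set (seq V)) :
  measurable [set s : perm_borel V | B (map s Y)].
Proof.
rewrite (_ : mkset _ = \bigcup_(Z in B) [set s : perm_borel V | map s Y = Z]).
  by apply: countable_bigcup_measurable => Z _; exact: measurable_map_eq.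
by apply/seteqP; split=> s /=; [exists (map s Y)|move=> [Z BZ ->]].
Qed.

End PermutationBorel.

(** * Fair coins *)

Lemma measurable_bool_pred d (T : measurableType d) (c : T -> bool) :
  measurable [set w | c w] -> forall b, measurable [set w | c w = b].
Proof.
move=> mc [] //.
rewrite (_ : [set w | _] = ~` [set w | c w]); first exact: measurableC.
by apply/seteqP; split=> w /=; [move=> ->|move/negP/negbTE].
Qed.

Section FairCoins.
Context (R : realType).
Implicit Types (w : measurableTypeR R) (b : nat -> bool).

(** The binary digits of a uniform real in [0, 1] are independent fair coins, so a single real
    supplies a coin for every pair of an infinite matching. *)
Definition coin (i : nat) w : bool := odd (Num.truncn (2 ^+ i.+1 * w : R)).

Definition coin_law : probability (measurableTypeR R) R :=
  uniform_prob (@ltr01 R).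

Lemma measurable_coin i : measurable [set w | coin i w].
Proof.
rewrite (_ : mkset _ = \bigcup_(k in [set k | odd k])
    [set w : measurableTypeR R | Num.truncn (2 ^+ i.+1 * w : R) = k]);
      last first.
  apply/seteqP; split=> w /=; first by exists (Num.truncn (2 ^+ i.+1 * w : R)).
  by move=> [k ok wk]; rewrite /coin wk.
apply: bigcup_measurable => k _; apply: is_interval_measurable.
move=> x y /= xk yk z /andP[xz zy]; apply/eqP; rewrite eqn_leq.
rewrite -{1}yk -xk !le_truncn// ler_wpM2l//.
Qed.

(** The integer with binary digits b 0, ..., b (n - 1). Inside [0, 1[ the first n coins agree with
    [b] exactly on the dyadic interval of length 2^-n starting at prefix / 2^n. *)
Let prefix b n := foldl (fun k i => k.*2 + b i)%N 0%N (iota 0 n).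

Let prefixS b n : prefix b n.+1 = ((prefix b n).*2 + b n)%N.
Proof. by rewrite /prefix -addn1 iotaD foldl_cat. Qed.

Let coins_prefix b n w : 0 <= w < 1 ->
  (forall i, (i < n)%N -> coin i w = b i) <->
  Num.truncn (2 ^+ n * w : R) = prefix b n.
Proof.
move=> w01; have w0 : 0 <= w by case/andP: w01.
elim: n => [|n ih].
  by split=> // _; rewrite mul1r /prefix; exact: truncn_def.
set m := Num.truncn (2 ^+ n.+1 * w : R).
have mhalf : Num.truncn (2 ^+ n * w : R) = m./2.
  have : m%:R <= (2 ^+ n.+1 * w : R) < m.+1%:R.
    by apply: truncn_itv; rewrite mulr_ge0.
  rewrite exprS -mulrA => /andP[h1 h2].
  apply: truncn_def; apply/andP; split.
    rewrite -(ler_pM2l (ltr0Sn R 1)); apply: le_trans h1.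
    by rewrite -natrM ler_nat mul2n -[leqRHS]odd_double_half leq_addl.
  rewrite -(ltr_pM2l (ltr0Sn R 1)); apply: lt_le_trans h2 _.
  rewrite -natrM ler_nat mul2n doubleS -[X in (X < _)%N]odd_double_half.
  by rewrite -addn2 addnC -ltn_subLR ?leq_addr// addKn; case: odd.
rewrite prefixS; split.
  move=> h; have /ih : forall i, (i < n)%N -> coin i w = b i.
    by move=> i lin; apply: h; rewrite ltnS ltnW.
  rewrite mhalf => <-; rewrite -(h n)// /coin -/m.
  by rewrite addnC odd_double_half.
move=> mE; have bE : coin n w = b n.
  by rewrite /coin -/m mE oddD odd_double /= oddb.
have /ih h : Num.truncn (2 ^+ n * w : R) = prefix b n.
  by rewrite mhalf mE addnC half_bit_double.
by move=> i; rewrite ltnS leq_eqVlt => /predU1P[->//|]; exact: h.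
Qed.

Lemma measurable_coins b n :
  measurable [set w | forall i, (i < n)%N -> coin i w = b i].
Proof.
elim: n => [|n ih].
  by rewrite (_ : mkset _ = setT)//; apply/seteqP; split.
rewrite (_ : mkset _ = [set w | forall i, (i < n)%N -> coin i w = b i] `&`
                       [set w | coin n w = b n]).
  by apply: measurableI => //; apply: measurable_bool_pred;
    exact: measurable_coin.
apply/seteqP; split=> w /=.
  by move=> h; split=> [i lin|]; apply: h => //; rewrite ltnS ltnW.
by move=> [h1 h2] i; rewrite ltnS leq_eqVlt => /predU1P[->//|]; exact: h1.
Qed.

Lemma coin_law_coins b n :
  coin_law [set w | forall i, (i < n)%N -> coin i w = b i] = (2 ^- n)%:E.
Proof.
set E := mkset _.
pose p : R := (prefix b n)%:R / 2 ^+ n;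
  pose q : R := (prefix b n).+1%:R / 2 ^+ n.
have p2n : 0 < 2 ^+ n :> R by rewrite exprn_gt0.
have EI : E `&` `[0, 1[ = `[p, q[ `&` `[0, 1[.
  apply/seteqP; split=> w [] /= h w01; split=> //; move: w01 h;
    rewrite !in_itv/= => w01; have w0 : 0 <= w by case/andP: w01.
    move/(coins_prefix b n w01) => h.
    have := @truncn_itv R (2 ^+ n * w) (mulr_ge0 (ltW p2n) w0).
    by rewrite h /p /q ler_pdivrMr// ltr_pdivlMr// [w * _]mulrC.
  rewrite /p /q ler_pdivrMr// ltr_pdivlMr// [w * _]mulrC => h.
  by apply/(coins_prefix b n w01); exact: truncn_def.
have prefix_lt : (prefix b n < 2 ^ n)%N.
  elim: n {E p q p2n EI} => // n ih; rewrite prefixS expnS mul2n.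
  apply: (@leq_trans (prefix b n).+1.*2); last by rewrite leq_double.
  by rewrite doubleS; case: (b n); rewrite ?addn1 ?addn0 // ltnS.
have pq : `[p, q[ `<=` `[0, 1[.
  move=> w; rewrite /= !in_itv/= => /andP[pw wq].
  rewrite (le_trans _ pw) ?divr_ge0// ?ltW//; apply: lt_le_trans wq _.
  by rewrite /q ler_pdivrMr// mul1r -natrX ler_nat.
have law_itv (a c : R) : 0 <= a -> a < c -> c <= 1 ->
    coin_law `[a, c[%classic = (c - a)%:E.
  move=> a0 ac c1; rewrite /coin_law/= /uniform_prob.
  rewrite (eq_integral (fun=> 1%:E)); last first.
    move=> w; rewrite inE/= in_itv/= => /andP[aw wc].
    rewrite /uniform_pdf (le_trans a0 aw) (ltW (lt_le_trans wc c1)).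
    by rewrite subr0 invr1.
  by rewrite integral_cst//= mul1e lebesgue_measure_itv/= lte_fin ac EFinB.
have mE : measurable E := measurable_coins b n.
(* The digit description holds only on [0, 1[, so the event is first cut down to this interval of
   full mass. *)
have coin_law01 : coin_law `[0, 1[%classic = 1%E.
  by rewrite law_itv ?subr0.
rewrite -(@probability_setI1 _ _ _ coin_law E `[0, 1[%classic)// EI.
rewrite setIidl// law_itv.
- by rewrite /q /p -mulrBl -natr1 addrAC subrr add0r div1r.
- by rewrite divr_ge0// ltW.
- by rewrite /p /q ltr_pM2r ?invr_gt0// ltr_nat.
- by rewrite /q ler_pdivrMr// mul1r -natrX ler_nat.
Qed.

(** Split by the pattern [g] of the first n coins: each pattern has mass 2^-n, and distributivity
    folds the sum over patterns back into a product. *)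
Lemma integral_prod_coins n (f : 'I_n -> bool -> R) :
  (forall i c, 0 <= f i c) ->
  (\int[coin_law]_w (\prod_(i < n) f i (coin i w))%:E)%E =
  (\prod_(i < n) ((f i false + f i true) / 2))%:E.
Proof.
move=> f0.
pose E (g : {ffun 'I_n -> bool}) := [set w | forall i : 'I_n, coin i w = g i].
have EE g : E g = [set w | forall i, (i < n)%N ->
    coin i w = oapp g false (insub i)].
  apply/seteqP; split=> w /= h i.
    by move=> lin; rewrite insubT/= (h (Ordinal lin)).
  by rewrite (h i (ltn_ord i)) valK.
have mE g : measurable (E g) by rewrite EE; exact: measurable_coins.
have PE g : coin_law (E g) = (2 ^- n)%:E.
  by rewrite EE; exact: (coin_law_coins (fun i => oapp g false (insub i))).
have -> : (fun w => (\prod_(i < n) f i (coin i w))%:E) =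
  (fun w => \sum_(g : {ffun 'I_n -> bool})
    ((\prod_(i < n) f i (g i))%:E * (\1_(E g) w)%:E))%E.
  apply/funext => w; pose g0 := [ffun i : 'I_n => coin i w].
  rewrite (bigD1 g0)//= [X in (_ + X)%E]big1; last first.
    move=> g; rewrite indicE; case: (boolP (w \in E g)); last by rewrite mule0.
    rewrite inE => h /eqP[]; apply/ffunP => i; rewrite ffunE; exact/esym/h.
  rewrite adde0 indicE mem_set ?mule1; last by move=> i; rewrite ffunE.
  by congr (_%:E); apply: eq_bigr => i _; rewrite ffunE.
rewrite ge0_integral_sum//; last 2 first.
- by move=> g; apply/measurable_EFinP; apply: measurable_funM => //.
- by move=> g w _; rewrite lee_fin mulr_ge0 ?prodr_ge0.
rewrite (eq_bigr (fun g : {ffun 'I_n -> bool} =>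
    ((\prod_(i < n) f i (g i)) / 2 ^+ n)%:E)); last first.
  move=> g _; rewrite ge0_integralZl_EFin//; last 2 first.
  - by apply/measurable_EFinP.
  - by rewrite prodr_ge0.
  rewrite EFinM; congr (_ * _)%E.
  by rewrite integral_indic// setIT; exact: PE.
rewrite sumEFin; congr EFin; rewrite -mulr_suml -bigA_distr_bigA /=.
rewrite -exprVn -[in X in _ * _ ^+ X](card_ord n) -prodr_const -big_split /=.
by apply: eq_bigr => i _; rewrite big_bool/= addrC.
Qed.

End FairCoins.

(** * Random matchings *)

Section ImageLaw.
Context d d' (T : measurableType d) (S : measurableType d') (R : realType).
Context (P : probability T R) (f : T -> S) (mf : measurable_fun setT f).

Definition image_law : probability S R :=
  distribution P (mfun_Sub (mem_set mf) : {mfun T >-> S}).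

Lemma image_lawE A : image_law A = P (f @^-1` A).
Proof. by []. Qed.

Lemma integral_image_law (g : S -> \bar R) :
  measurable_fun setT g -> (forall y, 0 <= g y)%E ->
  (\int[image_law]_y g y = \int[P]_x g (f x))%E.
Proof.
move=> mg g0.
by rewrite (@ge0_integral_pushforward _ _ _ _ _ f mf P setT g).
Qed.

End ImageLaw.

Section RandomMatching.
Context (R : realType) (V : countType) (m : V -> V) (mK : involutive m).

(** A label shared by x and [m x] and by no other site, so that one coin decides for the whole
    pair. *)
Definition pair_index (x : V) : nat :=
  minn (choice.pickle x) (choice.pickle (m x)).

Lemma pair_index_inv x : pair_index (m x) = pair_index x.
Proof. by rewrite /pair_index mK minnC. Qed.

Lemma pair_index_eq x y : pair_index x = pair_index y -> y = x \/ y = m x.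
Proof.
rewrite /pair_index /minn.
by case: ifP => _; case: ifP => _ /(pcan_inj choice.pickleK) h;
  [left|right; rewrite h mK|right; rewrite h|left; apply: (can_inj mK)].
Qed.

Definition flip_pairs (c : nat -> bool) (x : V) : V :=
  if c (pair_index x) then m x else x.

Lemma flip_pairsK c : involutive (flip_pairs c).
Proof.
move=> x; rewrite /flip_pairs; case cx: (c (pair_index x)).
  by rewrite pair_index_inv cx mK.
by rewrite cx.
Qed.

Definition matching_perm (w : measurableTypeR R) : perm_borel V :=
  Permutation (flip_pairsK (fun i => coin i w)) (flip_pairsK (fun i => coin i
    w)).

Lemma measurable_matching_perm : measurable_fun setT matching_perm.
Proof.
apply: measurable_perm_fun => x y /=.
have mc b : measurable [set w : measurableTypeR R | coin (pair_index x) w = b].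
  by apply: measurable_bool_pred; exact: measurable_coin.
rewrite (_ : mkset _ = \bigcup_(b in [set b | (if b then m x else x) = y])
    [set w : measurableTypeR R | coin (pair_index x) w = b]).
  by apply: countable_bigcup_measurable => b _; exact: mc.
apply/seteqP; split=> w; rewrite /flip_pairs /=.
  by exists (coin (pair_index x) w).
by move=> [b /= by_ ->].
Qed.

Definition matching_law : probability (perm_borel V) R :=
  image_law (coin_law R) measurable_matching_perm.

Lemma matching_law_symmetric : symmetric_law matching_law.
Proof.
move=> A mA; rewrite /matching_law !image_lawE.
congr (coin_law R _); apply/seteqP; split=> w /=; rewrite /preimage /=;
  by rewrite (_ : perm_inverse _ = matching_perm w)//; exact: perm_eqP.
Qed.

Lemma prod_pair_index (Y : seq V) n (F : V -> R) :
  (forall x, x \in Y -> (pair_index x < n)%N) ->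
  \prod_(x <- Y) F x =
  \prod_(i < n) \prod_(x <- Y | pair_index x == i) F x.
Proof.
move=> hn; rewrite (exchange_big_dep predT)//= big_seq [RHS]big_seq.
apply: eq_bigr => x xY; by rewrite (big_pred1 (Ordinal (hn x xY))).
Qed.

Definition pair_mean (h : V -> R) (x : V) : R := (h x + h (m x)) / 2.

Lemma integral_prod_matching (Y : seq V) (h : V -> R) n :
  (forall x, 0 <= h x) -> (forall x, x \in Y -> (pair_index x < n)%N) ->
  (\int[matching_law]_s (\prod_(x <- Y) h (s x))%:E)%E =
  (\prod_(i < n) ((\prod_(x <- Y | pair_index x == i) h x +
                   \prod_(x <- Y | pair_index x == i) h (m x)) / 2))%:E.
Proof.
move=> h0 hn.
rewrite integral_image_law; last 2 first.
- apply/measurable_EFinP; apply: measurable_prod => x _.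
  by apply: measurable_countable_comp => y; exact: measurable_eval.
- by move=> s; rewrite lee_fin prodr_ge0.
pose f (i : 'I_n) (b : bool) :=
  \prod_(x <- Y | pair_index x == i) h (if b then m x else x).
rewrite -(integral_prod_coins (f := f)); last first.
  by move=> i b; rewrite prodr_ge0.
apply: eq_integral => w _; congr EFin.
rewrite (prod_pair_index _ hn); apply: eq_bigr => i _; rewrite /f.
by apply: eq_bigr => x /eqP xi; rewrite /= /flip_pairs xi.
Qed.

Lemma matching_law_mean (h : V -> R) x : (forall y, 0 <= h y) ->
  (\int[matching_law]_s (h (s x))%:E)%E = (pair_mean h x)%:E.
Proof.
move=> h0; have := @integral_prod_matching [:: x] h (pair_index x).+1 h0.
under eq_integral do rewrite big_seq1.
move=> ->; last by move=> y; rewrite inE => /eqP ->.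
rewrite big_ord_recr/= big1; last first.
  by move=> i _; rewrite !big_cons !big_nil gtn_eqF//= mulfV ?pnatr_eq0.
by rewrite !big_cons !big_nil eqxx !mulr1 mul1r.
Qed.

Lemma matching_law_negdep (h : V -> R) Y : (forall x, 0 <= h x) -> uniq Y ->
  (\int[matching_law]_s (\prod_(x <- Y) h (s x))%:E <=
   (\prod_(x <- Y) pair_mean h x)%:E)%E.
Proof.
move=> h0 uY; pose n := (\max_(x <- Y) pair_index x).+1.
have hn x : x \in Y -> (pair_index x < n)%N.
  by move=> xY; rewrite ltnS; apply: leq_bigmax_seq.
rewrite (integral_prod_matching h0 hn) lee_fin (prod_pair_index _ hn).
apply: ler_prod => i _; rewrite divr_ge0 ?addr_ge0 ?prodr_ge0//=.
rewrite -!(big_filter _ (fun x => pair_index x == i)).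
have : forall x, x \in [seq x <- Y | pair_index x == i] -> pair_index x = i.
  by move=> x; rewrite mem_filter => /andP[/eqP].
have : uniq [seq x <- Y | pair_index x == i] by exact: filter_uniq.
(* A list without repetition meets a pair in at most two sites. With one site or none there is
   equality; with both, h(x) h(m x) is compared with the squared mean; a third entry would be a
   repetition. *)
move: [seq x <- Y | _] => [|x [|y [|z s]]] uZ hi.
- by rewrite !big_nil mulfV.
- by rewrite !big_seq1.
- have yE : y = m x.
    have : pair_index x = pair_index y by rewrite !hi ?inE ?eqxx ?orbT.
    by move/pair_index_eq => [yx|//]; move: uZ; rewrite yx /= inE eqxx.
  rewrite !big_cons !big_nil !mulr1 yE /pair_mean mK.
  have := sqr_ge0 (h x - h (m x)); nra.
have yE : y = m x.
  have : pair_index x = pair_index y by rewrite !hi ?inE ?eqxx ?orbT.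
  by move/pair_index_eq => [yx|//]; move: uZ; rewrite yx /= inE eqxx.
have zE : z = m x.
  have : pair_index x = pair_index z by rewrite !hi ?inE ?eqxx ?orbT.
  move/pair_index_eq => [zx|//]; move: uZ.
  by rewrite zx /= !inE eqxx !orbT.
by move: uZ; rewrite yE zE /= !inE eqxx /= andbF.
Qed.

End RandomMatching.

(** * Convolution *)

Section Convolution.
Context (R : realType) (V : countType).
Local Notation perm := (perm_borel V).
Implicit Types mu nu : probability perm R.

(** The permutation of law [mu] acts first, that of law [nu] second. *)
Definition convolution mu nu : probability perm R :=
  image_law (mu \x nu)%E (@measurable_perm_comp V).

Lemma measurable_perm_compl (t : perm) :
  measurable_fun setT (fun s : perm => perm_comp t s : perm).
Proof.
apply: measurable_perm_fun => x y /=.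
exact: (@measurable_eval_in _ x [set z | t z = y]).
Qed.

Lemma measurable_perm_compr (s : perm) :
  measurable_fun setT (fun t : perm => perm_comp t s : perm).
Proof.
apply: measurable_perm_fun => x y /=; exact: (@measurable_eval _ (s x) y).
Qed.

Section Integral.
Context (mu nu : probability perm R) (g : perm -> \bar R).
Hypotheses (mg : measurable_fun setT g) (g0 : forall s, (0 <= g s)%E).

Let mgc : measurable_fun setT
  (fun st : perm * perm => g (perm_comp st.2 st.1)).
Proof. exact: (measurableT_comp mg (@measurable_perm_comp V)). Qed.

Lemma integral_convolution :
  (\int[convolution mu nu]_s g s =
   \int[mu]_s \int[nu]_t g (perm_comp t s))%E.
Proof.
rewrite integral_image_law//.
by rewrite (@fubini_tonelli1 _ _ _ _ _ mu nu _ mgc).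
Qed.

Lemma integral_convolution_swap :
  (\int[convolution mu nu]_s g s =
   \int[nu]_t \int[mu]_s g (perm_comp t s))%E.
Proof.
rewrite integral_convolution.
by rewrite (@fubini_tonelli _ _ _ _ _ mu nu _ mgc).
Qed.

Lemma measurable_integral_comp :
  measurable_fun setT (fun s : perm => \int[nu]_t g (perm_comp t s))%E.
Proof. exact: (@measurable_fun_fubini_tonelli_F _ _ _ _ _ nu _ mgc). Qed.

Lemma measurable_integral_comp_swap :
  measurable_fun setT (fun t : perm => \int[mu]_s g (perm_comp t s))%E.
Proof. exact: (@measurable_fun_fubini_tonelli_G _ _ _ _ _ mu _ mgc). Qed.

End Integral.

Lemma law_indic mu (A : set perm) : measurable A ->
  mu A = (\int[mu]_s (\1_A s)%:E)%E.
Proof. by move=> mA; rewrite integral_indic// setIT. Qed.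

Definition inverse_law mu nu :=
  forall A : set perm, measurable A -> mu [set s | A (perm_inverse s)] = nu A.

Lemma integral_inverse mu nu (g : perm -> \bar R) :
  inverse_law mu nu -> measurable_fun setT g -> (forall s, (0 <= g s)%E) ->
  (\int[mu]_s g (perm_inverse s) = \int[nu]_s g s)%E.
Proof.
move=> inv mg g0.
rewrite -(integral_image_law mu (@measurable_perm_inverse V))//.
apply: eq_measure_integral => A mA _.
exact: inv.
Qed.

Lemma inverse_convolution mu mu' nu nu' :
  inverse_law mu mu' -> inverse_law nu nu' ->
  inverse_law (convolution mu nu) (convolution nu' mu').
Proof.
move=> imu inu A mA.
have mA' : measurable [set s : perm | A (perm_inverse s)].
  by rewrite -[X in measurable X]setTI; exact: measurable_perm_inverse.
have m1 (B : set perm) : measurable B -> measurable_fun setT (fun s : perm =>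
  (\1_B s)%:E : \bar R).
  by move=> mB; apply/measurable_EFinP.
have i0 (B : set perm) s : (0 <= (\1_B s)%:E :> \bar R)%E by rewrite lee_fin.
rewrite !law_indic// integral_convolution//; last exact: m1.
rewrite integral_convolution_swap//; last exact: m1.
rewrite -(integral_inverse imu); last 2 first.
- exact: (measurable_integral_comp_swap nu' (m1 A mA) (i0 A)).
- by move=> s; apply: integral_ge0.
apply: eq_integral => s _.
rewrite -(integral_inverse inu); last 2 first.
- exact: (measurableT_comp (m1 A mA) (measurable_perm_compl _)).
- by [].
apply: eq_integral => t _; congr (_%:E).
Qed.

Lemma convolution_assoc (l mu nu : probability perm R) (A : set perm) :
  measurable A ->
  convolution (convolution l mu) nu A = convolution l (convolution mu nu) A.
Proof.
move=> mA; have m1 : measurable_fun setT (fun s : perm => (\1_A s)%:E : \bar R).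
  exact/measurable_EFinP.
have i0 (s : perm) : (0 <= (\1_A s)%:E :> \bar R)%E by rewrite lee_fin.
rewrite !law_indic//.
rewrite integral_convolution; [|exact: m1|exact: i0].
rewrite integral_convolution; last 2 first.
- exact: (measurable_integral_comp nu m1 i0).
- by move=> s; apply: integral_ge0.
rewrite integral_convolution; [|exact: m1|exact: i0].
apply: eq_integral => s _; rewrite integral_convolution; last 2 first.
- exact: (measurableT_comp m1 (measurable_perm_compr s)).
- by move=> t; exact: i0.
apply: eq_integral => t _; apply: eq_integral => u _.
by congr (\1_A _)%:E; apply: perm_eqP.
Qed.

(** Inversion sends a convolution of symmetric laws to the convolution in the opposite order, in
    general a different law. A palindrome is its own reversal up to associativity. *)
Lemma symmetric_law_sandwich mu nu : symmetric_law mu -> symmetric_law nu ->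
  symmetric_law (convolution nu (convolution mu nu)).
Proof.
move=> smu snu.
have i1 : inverse_law mu mu by move=> A mA; rewrite -smu.
have i2 : inverse_law nu nu by move=> A mA; rewrite -snu.
move=> A mA; rewrite (inverse_convolution i2 (inverse_convolution i1 i2))//.
by rewrite convolution_assoc.
Qed.

Definition negdep_mean mu (M : (V -> R) -> V -> R) :=
  forall h : V -> R, (forall x, 0 <= h x) ->
  (forall x, \int[mu]_s (h (s x))%:E = (M h x)%:E)%E /\
  (forall Y, uniq Y ->
    (\int[mu]_s (\prod_(x <- Y) h (s x))%:E <= (\prod_(x <- Y) M h x)%:E)%E).

Lemma negdep_mean_ge0 mu M h x : negdep_mean mu M -> (forall x, 0 <= h x) ->
  0 <= M h x.
Proof.
move=> nd h0; rewrite -lee_fin -(nd h h0).1.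
by apply: integral_ge0 => s _; rewrite lee_fin.
Qed.

Lemma measurable_prod_eval (h : V -> R) (Y : seq V) :
  measurable_fun setT (fun s : perm => (\prod_(x <- Y) h (s x))%:E).
Proof.
apply/measurable_EFinP; apply: measurable_prod => x _.
by apply: measurable_countable_comp => y; exact: measurable_eval.
Qed.

(** Condition on the first permutation [s]. Being injective, it sends [Y] to distinct sites, where
    the bound for [nu] applies; what remains is the bound for [mu] at the nonnegative function
    [N h]. *)
Lemma negdep_mean_convolution mu nu M N : negdep_mean mu M ->
  negdep_mean nu N -> negdep_mean (convolution mu nu) (M \o N).
Proof.
move=> ndM ndN h h0.
have N0 x : 0 <= N h x by exact: negdep_mean_ge0 ndN h0.
split=> [x|Y uY].
  rewrite integral_convolution; last 2 first.
  - have := measurable_prod_eval h [:: x].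
    by under eq_fun do rewrite big_seq1.
  - by move=> s; rewrite lee_fin.
  rewrite /= -(ndM _ N0).1; apply: eq_integral => s _ /=.
  by rewrite -(ndN h h0).1.
rewrite integral_convolution; last 2 first.
- exact: measurable_prod_eval.
- by move=> s; rewrite lee_fin prodr_ge0.
apply: le_trans ((ndM _ N0).2 Y uY).
apply: ge0_le_integral => //.
- by move=> s _; apply: integral_ge0 => t _; rewrite lee_fin prodr_ge0.
- apply: (measurable_integral_comp nu (measurable_prod_eval h Y)).
  by move=> s; rewrite lee_fin prodr_ge0.
- exact: measurable_prod_eval.
move=> s _; have := (ndN h h0).2 (map s Y); rewrite big_map => H.
rewrite (eq_integral (fun t : perm => (\prod_(x <- map s Y) h (t x))%:E)).
  by apply: H; rewrite map_inj_uniq//; exact: (can_inj (pfunK s)).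
by move=> t _; rewrite big_map.
Qed.

End Convolution.

(** * Markov chains with finitely supported transitions *)

Section FiniteSupport.
Local Open Scope ereal_scope.
Context d (T : measurableType d) (R : realType) (P : probability T R).
Context (W : choiceType) (Z : T -> W) (s : seq W).
Hypotheses (mZ : forall B : set W, measurable (Z @^-1` B)) (us : uniq s).

Let mZ1 (A : set T) z : measurable A -> measurable (A `&` [set w | Z w = z]).
Proof. by move=> mA; apply: measurableI => //; exact: (mZ [set z]). Qed.

Let bigsetUE (A : set T) :
  \big[setU/set0]_(z <- s) (A `&` [set w | Z w = z]) =
  A `&` [set w | Z w \in s].
Proof.
rewrite -bigcup_seq; apply/seteqP; split=> w /=.
  by move=> [z zs [Aw Zz]]; rewrite Zz.
by move=> [Aw zs]; exists (Z w).
Qed.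

Let triv (A : set T) :
  trivIset [set` s] (fun z => A `&` [set w | Z w = z]).
Proof. by move=> z1 z2 _ _ [w [[_ /= <-] [_ /= <-]]]. Qed.

Lemma measure_support (A : set T) : measurable A ->
  P (A `&` [set w | Z w \in s]) =
  \sum_(z <- s) P (A `&` [set w | Z w = z]).
Proof.
move=> mA; rewrite -bigsetUE.
rewrite -[LHS]mul1e -integral_cst; last first.
  by rewrite bigsetUE; apply: measurableI => //; exact: (mZ [set z | z \in s]).
rewrite (ge0_integral_bigsetU P (fun z => mZ1 z mA) us (@triv A))//.
by apply: eq_bigr => z _; rewrite integral_cst ?mul1e//; exact: mZ1.
Qed.

Lemma integral_support (A : set T) (F : T -> \bar R) : measurable A ->
  P (A `&` [set w | Z w \notin s]) = 0 ->
  measurable_fun setT F -> (forall w, 0 <= F w) ->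
  \int[P]_(w in A) F w =
  \sum_(z <- s) \int[P]_(w in A `&` [set w | Z w = z]) F w.
Proof.
move=> mA N0 mF F0.
have mN : measurable (A `&` [set w | Z w \notin s]).
  by apply: measurableI => //; exact: (mZ [set z | z \notin s]).
rewrite (ge0_negligible_integral mN mA _ _ N0)//; last exact: measurable_funTS.
rewrite (_ : A `\` _ = \big[setU/set0]_(z <- s) (A `&` [set w | Z w = z])).
  rewrite ge0_integral_bigsetU//; first by move=> z; exact: mZ1.
  exact: measurable_funTS.
rewrite bigsetUE; apply/seteqP; split=> w /= [Aw].
  by move=> /not_andP[//|/negP]; rewrite negbK.
by move=> Zs; split=> // -[_]; rewrite Zs.
Qed.

End FiniteSupport.

Section FeynmanKac.
Context (R : realType) (V : choiceType) (p : V -> V -> R) (supp : V -> seq V).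

Definition step_mean (f : V -> R) (z : V) : R := \sum_(y <- supp z) p z y * f y.

(** Feynman-Kac recursion: the expectation of g(X_1) ... g(X_n) for the chain started at z. Time 0
    carries no weight. *)
Fixpoint path_weight (g : V -> R) (n : nat) (z : V) : R :=
  if n is n'.+1 then step_mean (fun y => g y * path_weight g n' y) z else 1.

Hypotheses (usupp : forall z, uniq (supp z))
  (psupp : forall z, \sum_(y <- supp z) p z y = 1).
Context (x0 : V) d (Om : measurableType d) (P : probability Om R)
  (X : nat -> Om -> V).
Hypothesis mc : markov_chain p x0 P X.

Let mX n (B : set V) : measurable (X n @^-1` B).
Proof. by case: mc. Qed.

Let hist (n : nat) (h : nat -> V) : set Om :=
  [set w | forall k, (k <= n)%N -> X k w = h k].

Let mhist n h : measurable (hist n h).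
Proof.
rewrite (_ : hist n h = \bigcap_(k in [set k | (k <= n)%N]) (X k @^-1` [set h
  k])).
  by apply: bigcap_measurable => [|k _]; [exists 0%N|exact: mX].
by apply/seteqP; split=> w /= hw k; exact: hw.
Qed.

(** By the one-step rule the masses of the next states in [supp (h n)] already sum to the mass of
    the history, which leaves nothing outside. *)
Let hist_null n h : P (hist n h `&` [set w | X n.+1 w \notin supp (h n)]) = 0%E.
Proof.
have [_ _ mcS] := mc.
have mS : measurable [set w | X n.+1 w \in supp (h n)].
  exact: (mX n.+1 [set z | z \in supp (h n)]).
have : P (hist n h) = (P (hist n h `\` [set w | X n.+1 w \in supp (h n)]) +
    P (hist n h `&` [set w | X n.+1 w \in supp (h n)]))%E.
  exact: measureDI (mhist n h) mS.
rewrite (measure_support P (mX n.+1) (usupp (h n)))//.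
have -> : (\sum_(z <- supp (h n)) P (hist n h `&` [set w | X n.+1 w = z]) =
    P (hist n h))%E.
  under eq_bigr => z _ do rewrite (mcS n h z : P (_ `&` _) = _).
  have : P (hist n h) \is a fin_num by exact: fin_num_measure.
  case: (P (hist n h)) => // a _.
  by under eq_bigr do rewrite -EFinM; rewrite sumEFin -mulr_sumr psupp mulr1.
rewrite setDE (_ : ~` _ = [set w | X n.+1 w \notin supp (h n)]); last first.
  by apply/seteqP; split=> w /= /negP.
have : P (hist n h) \is a fin_num by exact: fin_num_measure.
case: (P (hist n h)) => // a _; case: (P (_ `&` _)) => //= b [] /eqP.
by rewrite eq_sym -subr_eq0 addrK => /eqP ->.
Qed.

(** Induction on n for all histories at once: fixing the next state z lengthens the history by one,
    and the one-step rule supplies the factor p (h k) z. *)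
Lemma integral_path_weight_hist (g : V -> R) n k h : (forall y, 0 <= g y) ->
  (\int[P]_(w in hist k h) (\prod_(i < n) g (X (k.+1 + i)%N w))%:E =
   P (hist k h) * (path_weight g n (h k))%:E)%E.
Proof.
move=> g0; have [_ _ mcS] := mc.
have mg j : measurable_fun setT (fun w => g (X j w)).
  by move=> _ B mB; rewrite setTI; exact: (mX j (g @^-1` B)).
elim: n k h => [|n ih] k h.
  under eq_integral do rewrite big_ord0.
  by rewrite integral_cst ?mul1e ?mule1.
rewrite (@integral_support _ _ _ P _ _ _ (mX k.+1) (usupp (h k)) _ _ (mhist k
  h)); last 3 first.
- exact: hist_null.
- by apply/measurable_EFinP; apply: measurable_prod.
- by move=> w; rewrite lee_fin prodr_ge0.
have Pfin : P (hist k h) \is a fin_num by exact: fin_num_measure.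
rewrite -(fineK Pfin) /= /step_mean -EFinM mulr_sumr -sumEFin.
apply: eq_bigr => z _; pose h' j := if (j <= k)%N then h j else z.
have hh' : hist k h `&` [set w | X k.+1 w = z] = hist k.+1 h'.
  apply/seteqP; split=> w /=.
    move=> [hw wz] j; rewrite leq_eqVlt => /predU1P[->|].
      by rewrite /h' ltnn.
    by rewrite ltnS => jk; rewrite /h' jk; exact: hw.
  move=> hw; split=> [j jk|]; last by rewrite hw// /h' ltnn.
  by rewrite hw ?leqW// /h' jk.
have /(_ z) := mcS k h; rewrite -[X in P X](_ : hist k.+1 h' = _); last first.
  by rewrite -hh'.
move=> Phz; rewrite hh'.
under eq_integral => w _.
  rewrite big_ord_recl addn0 EFinM.
  under eq_bigr do rewrite /bump /= addnS -addSn.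
  over.
rewrite (eq_integral (fun w => (g z)%:E *
  (\prod_(i < n) g (X (k.+2 + i)%N w))%:E)%E); last first.
  by move=> w; rewrite inE => hw; rewrite hw// /h' ltnn.
rewrite ge0_integralZl_EFin//; last 2 first.
- by move=> w _; rewrite lee_fin prodr_ge0.
- by apply/measurable_EFinP/measurable_funTS; apply: measurable_prod.
rewrite ih Phz /h' ltnn -(fineK Pfin) -!EFinM; congr (_%:E).
by rewrite mulrCA -!mulrA.
Qed.

Lemma markov_chain_path_weight (g : V -> R) n : (forall y, 0 <= g y) ->
  (\int[P]_w (\prod_(i < n) g (X i.+1 w))%:E = (path_weight g n x0)%:E)%E.
Proof.
move=> g0; have [_ P0 _] := mc.
have := @integral_path_weight_hist g n 0 (fun=> x0) g0.
have h0 : hist 0 (fun=> x0) = [set w | X 0 w = x0].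
  apply/seteqP; split=> w /= h; first exact: h.
  by move=> k; rewrite leqn0 => /eqP ->.
rewrite {2}h0 P0 mul1e => <-.
have N0 : P (~` hist 0 (fun=> x0)) = 0%E.
  by rewrite probability_setC// h0 P0 subee.
have mg j : measurable_fun setT (fun w => g (X j w)).
  by move=> _ B mB; rewrite setTI; exact: (mX j (g @^-1` B)).
rewrite (ge0_negligible_integral (measurableC (mhist 0 _)) _ _ _ N0)//.
- by rewrite setTD setCK; apply: eq_integral.
- by apply/measurable_EFinP; apply: measurable_prod.
- by move=> w _; rewrite lee_fin prodr_ge0.
Qed.

End FeynmanKac.

(** * Chains driven by independent random maps *)

Section IidSequences.
Context (R : realType) (dO dS : measure_display) (Om : measurableType dO).
Context (S : measurableType dS) (P : probability Om R) (mu : probability S R).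
Implicit Types s : nat -> {mfun Om >-> S}.

Lemma iid_law_shift s j : iid_law P mu s -> iid_law P mu (fun i => s (j + i)%N).
Proof.
move=> [law ind]; split=> [i A mA|J A mA]; first exact: law.
have inj : injective (addn j) by move=> a b; exact: addnI.
have := ind [fset (j + i)%N | i in J]%fset (fun k => A (k - j)%N)
  (fun k => mA (k - j)%N).
rewrite big_imfset/=; last by move=> a b _ _; exact: inj.
under eq_bigr do rewrite addKn.
move=> <-; congr (P _); apply/seteqP; split=> w /= hw k /=.
  by move=> /imfsetP[i /= iJ ->]; rewrite addKn; exact: hw.
by move=> kJ; have := hw (j + k)%N; rewrite /= addKn; apply; exact: in_imfset.
Qed.

Lemma iid_law_prefix s n (A : nat -> set S) : iid_law P mu s ->
  (forall i, measurable (A i)) ->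
  P [set w | forall i, (i < n)%N -> A i (s i w)] = (\prod_(i < n) mu (A i))%E.
Proof.
move=> [law ind] mA; have := ind [fset i | i in iota 0 n]%fset A mA.
have -> : [set` [fset i | i in iota 0 n]%fset] = [set i | (i < n)%N].
  by apply/seteqP; split=> i /=; rewrite !inE /= mem_iota add0n.
rewrite (perm_big (iota 0 n)); last first.
  apply: uniq_perm; rewrite ?iota_uniq ?fset_uniq// => i.
  by rewrite !inE.
rewrite -(big_mkord xpredT (fun i => mu (A i))) /index_iota subn0 => h.
transitivity (\prod_(i <- iota 0 n) P (s i @^-1` A i))%E.
  by rewrite -h; congr (P _); apply/seteqP; split.
by apply: eq_bigr => i _; rewrite -(law i).
Qed.

End IidSequences.

(** The action is arbitrary so that the same chain describes one particle and, later, a whole list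
    of particles with killing. *)
Fixpoint map_chain (S W : Type) (act : S -> W -> W) (y0 : W) (s : nat -> S)
    (n : nat) : W :=
  if n is m.+1 then act (s m) (map_chain act y0 s m) else y0.

Section RandomMaps.
Context (R : realType) (dS : measure_display) (S : measurableType dS).
Context (mu : probability S R) (W : countType) (act : S -> W -> W).
Hypothesis mact : forall y z, measurable [set t | act t y = z].

Definition map_transition (y z : W) : R := fine (mu [set t | act t y = z]).

Lemma map_transitionE y z : (map_transition y z)%:E = mu [set t | act t y = z].
Proof. by rewrite fineK// fin_num_measure. Qed.

Lemma map_transition_ge0 y z : 0 <= map_transition y z.
Proof. exact: fine_ge0. Qed.

Lemma measurable_act_in y (B : set W) : measurable [set t | B (act t y)].
Proof.
rewrite (_ : mkset _ = \bigcup_(z in B) [set t | act t y = z]).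
  by apply: countable_bigcup_measurable => z _; exact: mact.
by apply/seteqP; split=> t /=; [exists (act t y)|move=> [z Bz ->]].
Qed.

Lemma iid_markov_chain dO (Om : measurableType dO) (P : probability Om R)
    (s : nat -> {mfun Om >-> S}) y0 : iid_law P mu s ->
  markov_chain map_transition y0 P (fun n w => map_chain act y0 (fun i => s i
    w) n).
Proof.
move=> iid; pose X n w := map_chain act y0 (fun i => s i w) n.
(* For a history starting at [y0], following [h] means that each [s i] sends h i to h i.+1; these
   events concern separate independent increments. *)
pose A (h : nat -> W) i := [set t | act t (h i) = h i.+1].
have mA h i : measurable (A h i) by exact: mact.
have histE n h : h 0%N = y0 ->
    [set w | forall k, (k <= n)%N -> X k w = h k] =
    [set w | forall i, (i < n)%N -> A h i (s i w)].
  move=> h0; apply/seteqP; split=> w /= hw.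
    by move=> i ilt; rewrite /A /= -(hw i (ltnW ilt)) -(hw i.+1 ilt).
  elim=> [|k ih] kn; first by rewrite h0.
  by rewrite /X /= -/(X k w) ih ?(ltnW kn)//; exact: hw.
have mX1 n (z : W) : measurable (X n @^-1` [set z]).
  elim: n z => [|n ih] z.
    have [<-|ne] := eqVneq y0 z.
      by rewrite (_ : _ @^-1` _ = setT)//; apply/seteqP; split.
    rewrite (_ : _ @^-1` _ = set0)//; apply/seteqP; split=> // w /= /eqP.
    by rewrite (negbTE ne).
  rewrite (_ : _ @^-1` _ = \bigcup_(y : W) (X n @^-1` [set y] `&`
      s n @^-1` [set t | act t y = z])).
    apply: countable_bigcup_measurable => y _; apply: measurableI;
      first exact: ih.
    by rewrite -[X in measurable X]setTI; apply: measurable_funP.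
  apply/seteqP; split=> w /=; first by exists (X n w).
  by move=> [y _ [/= <-]].
split=> [n B||n h y].
- rewrite (_ : _ @^-1` B = \bigcup_(z in B) (X n @^-1` [set z])).
    by apply: countable_bigcup_measurable => z _; exact: mX1.
  apply/seteqP; split=> w /=; first by exists (X n w).
  by move=> [z Bz Xz]; move: Bz; rewrite -Xz.
- rewrite (_ : mkset _ = setT) ?probability_setT//.
  by apply/seteqP; split.
have [h0|h0] := eqVneq (h 0%N) y0; last first.
  rewrite [X in P X](_ : _ = set0); last first.
    apply/seteqP; split=> // w /= -[/(_ 0%N (leq0n _)) /= y0h _].
    by move: h0; rewrite -y0h eqxx.
  rewrite [X in (P X * _)%E](_ : _ = set0) ?measure0 ?mul0e//.
  apply/seteqP; split=> // w /= /(_ 0%N (leq0n _)) /= y0h.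
  by move: h0; rewrite -y0h eqxx.
pose h' j := if (j <= n)%N then h j else y.
have h'E : [set w | (forall k, (k <= n)%N -> X k w = h k) /\ X n.+1 w = y] =
   [set w | forall k, (k <= n.+1)%N -> X k w = h' k].
  apply/seteqP; split=> w /=.
    move=> [hw wz] j; rewrite leq_eqVlt => /predU1P[->|].
      by rewrite /h' ltnn.
    by rewrite ltnS => jk; rewrite /h' jk; exact: hw.
  move=> hw; split=> [j jk|]; last by rewrite hw// /h' ltnn.
  by rewrite hw ?leqW// /h' jk.
rewrite h'E histE// (histE n h)// !(iid_law_prefix _ iid)// big_ord_recr/=.
congr (_ * _)%E; last by rewrite map_transitionE /A /h' leqnn ltnn.
apply: eq_bigr => i _; congr (mu _); rewrite /A /h' ltn_ord.
by rewrite (ltnW (ltn_ord i)).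
Qed.

Context (supp : W -> seq W).
Hypotheses (usupp : forall y, uniq (supp y))
  (musupp : forall y, mu [set t | act t y \in supp y] = 1%E).

Lemma map_transition_sum1 y : \sum_(z <- supp y) map_transition y z = 1.
Proof.
apply: EFin_inj; rewrite -sumEFin -(musupp y).
have := measure_support mu (measurable_act_in y) (usupp y) measurableT.
by rewrite setTI => ->; apply: eq_bigr => z _; rewrite map_transitionE setTI.
Qed.

Lemma integral_act y (f : W -> R) : (forall z, 0 <= f z) ->
  (\int[mu]_t (f (act t y))%:E = (step_mean map_transition supp f y)%:E)%E.
Proof.
move=> f0.
rewrite (@integral_support _ _ _ mu _ _ _ (measurable_act_in y) (usupp y) setT);
  last 4 first.
- by [].
- rewrite setTI (_ : mkset _ = ~` [set t | act t y \in supp y]).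
    rewrite probability_setC ?musupp ?subee//.
    exact: (measurable_act_in y [set z | z \in supp y]).
  by apply/seteqP; split=> t /= /negP.
- apply: (@measurable_countable_comp _ _ _ _ _ _ (fun z => (f z)%:E)).
  by move=> z; exact: mact.
- by move=> t; rewrite lee_fin.
rewrite /step_mean -sumEFin; apply: eq_bigr => z _; rewrite setTI.
rewrite (eq_integral (cst (f z)%:E)); last by move=> t; rewrite inE => /= ->.
by rewrite integral_cst//= EFinM map_transitionE muleC.
Qed.

End RandomMaps.

(** * Escape probabilities *)

Section Escape.
Context (R : realType) (V : choiceType) (p : V -> V -> R) (supp : V -> seq V).
Hypotheses (p0 : forall x y, 0 <= p x y) (usupp : forall z, uniq (supp z))
  (psupp : forall z, \sum_(y <- supp z) p z y = 1).

Let avoid (x y : V) : R := (y != x)%:R.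

(** With a weight vanishing at x and equal to 1 elsewhere, this is the probability that the chain
    from z avoids x at times 1, ..., n. Time 0 is not tested, so z = x gives the probability of no
    return. *)
Definition escape (x : V) (n : nat) (z : V) : R :=
  path_weight p supp (avoid x) n z.

Lemma ler_step_mean (f g : V -> R) z : (forall y, f y <= g y) ->
  step_mean p supp f z <= step_mean p supp g z.
Proof. by move=> fg; apply: ler_sum => y _; rewrite ler_wpM2l. Qed.

Lemma step_mean_ge0 (f : V -> R) z : (forall y, 0 <= f y) ->
  0 <= step_mean p supp f z.
Proof. by move=> f0; apply: sumr_ge0 => y _; rewrite mulr_ge0. Qed.

Section Chain.
Context (x0 : V) d (Om : measurableType d) (P : probability Om R)
  (X : nat -> Om -> V).
Hypothesis mc : markov_chain p x0 P X.

Let noret x n : set Om := [set w | forall i, (0 < i <= n)%N -> X i w <> x].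

Lemma measurable_avoid x n :
  measurable [set w | forall i, (0 < i <= n)%N -> X i w <> x].
Proof.
rewrite -[mkset _]/(noret x n).
rewrite (_ : noret x n = \bigcap_(i in [set i | (i < n)%N]) (X i.+1 @^-1` (~`
  [set x]))).
  have [mX _ _] := mc.
  elim: n => [|n ih].
    by rewrite (_ : bigcap _ _ = setT)//; apply/seteqP; split.
  rewrite (_ : bigcap _ _ = \bigcap_(i in [set i | (i < n)%N])
    (X i.+1 @^-1` (~` [set x])) `&` (X n.+1 @^-1` (~` [set x]))).
    by apply: measurableI => //; exact: mX.
  apply/seteqP; split=> w /=.
    by move=> h; split=> [i /= lin|]; apply: h; rewrite /= ltnS// ltnW.
  by move=> [h1 h2] i /=; rewrite ltnS leq_eqVlt => /predU1P[->//|]; exact: h1.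
apply/seteqP; split=> w h i /=; first by move=> lin; exact: h.
by case: i => // i; exact: h.
Qed.

Let mnoret x n : measurable (noret x n) := measurable_avoid x n.

Lemma probability_escape x n :
  P [set w | forall i, (0 < i <= n)%N -> X i w <> x] = (escape x n x0)%:E.
Proof.
rewrite -(markov_chain_path_weight usupp psupp mc)//.
transitivity (\int[P]_w (\1_(noret x n) w)%:E)%E.
  by rewrite integral_indic ?setIT//; exact: mnoret.
apply: eq_integral => w _; congr (_%:E); rewrite indicE.
have [h|] := boolP (w \in noret x n).
  rewrite inE /noret /= in h; rewrite big1// => i _.
  by rewrite /avoid; case: eqP => //; have := h i.+1 (ltn_ord i).
rewrite notin_setE /noret /= => /existsNP[i] /not_implyP[/andP[i0 lin]].
case: i i0 lin => // i _ lin /contrapT Xi.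
by rewrite (bigD1 (Ordinal lin))//= /avoid Xi eqxx mul0r.
Qed.

Lemma escape_cvg x :
  escape x n x0 @[n --> \oo] -->
  fine (P [set w | forall i, (0 < i)%N -> X i w <> x]).
Proof.
have E : [set w | forall i, (0 < i)%N -> X i w <> x] = \bigcap_n noret x n.
  apply/seteqP; split=> w /= h; first by move=> n _ i /andP[/h].
  by move=> i i0; apply: (h i) => //; rewrite i0 leqnn.
have mE : measurable (\bigcap_n noret x n) by exact: bigcapT_measurable.
have h : (P \o noret x) n @[n --> \oo] --> (fine (P (\bigcap_n noret x n)))%:E.
  rewrite fineK ?fin_num_measure//; apply: nonincreasing_cvg_mu => //.
    by rewrite ltey_eq fin_num_measure.
  move=> n m nm; apply/subsetPset => w /= h i /andP[i0 im].
  by apply: h; rewrite i0 (leq_trans im).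
rewrite E (_ : (fun n => escape x n x0) = fine \o (P \o noret x)).
  exact: fine_cvg h.
by apply/funext => n /=; rewrite probability_escape.
Qed.

Lemma escape_ge x n :
  fine (P [set w | forall i, (0 < i)%N -> X i w <> x]) <= escape x n x0.
Proof.
have E : [set w | forall i, (0 < i)%N -> X i w <> x] = \bigcap_n noret x n.
  apply/seteqP; split=> w /= h; first by move=> k _ i /andP[/h].
  by move=> i i0; apply: (h i) => //; rewrite i0 leqnn.
have mE : measurable (\bigcap_n noret x n) by exact: bigcapT_measurable.
rewrite -lee_fin fineK; last by rewrite E fin_num_measure.
rewrite -probability_escape; apply: le_measure; rewrite ?inE.
- by rewrite E.
- exact: mnoret.
- by move=> w /= h i /andP[/h].
Qed.

End Chain.

(* f / f x is superharmonic and equals 1 at x, so it dominates the probability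
   of hitting x. *)
Lemma superharmonic_escape (f : V -> R) x n z : (forall y, 0 < f y) ->
  (forall y, step_mean p supp f y <= f y) ->
  1 - step_mean p supp f z / f x <= escape x n z.
Proof.
move=> f0 fS; elim: n z => [|n ih] z.
  rewrite lerBlDr lerDl divr_ge0 ?(ltW (f0 _))//.
  by apply: step_mean_ge0 => y; exact: ltW.
have -> : 1 - step_mean p supp f z / f x =
    step_mean p supp (fun y => 1 - f y / f x) z.
  rewrite -{1}(psupp z) /step_mean mulr_suml -sumrB; apply: eq_bigr => y _.
  by rewrite mulrBr mulr1 mulrA.
apply: ler_step_mean => y; rewrite /avoid.
(* At y = x both sides vanish. Elsewhere superharmonicity replaces f y by its one-step mean, and the
   induction hypothesis applies. *)
have [->|_] := eqVneq y x; first by rewrite divff ?gt_eqF// subrr mul0r.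
rewrite mul1r; apply: le_trans (ih y).
by rewrite lerD2l lerN2 ler_wpM2r// invr_ge0 ltW.
Qed.

(** The superharmonic bound is uniform in n, so the probability of never returning to x is at least
    1 - step_mean f x / f x, positive by strictness at x. *)
Lemma superharmonic_transient (f : V -> R) : (forall y, 0 < f y) ->
  (forall y, step_mean p supp f y < f y) -> transient p.
Proof.
move=> f0 fS x d Om P X mc.
have fS' y : step_mean p supp f y <= f y by exact: ltW.
have lim : escape x n x @[n --> \oo] -->
    fine (P [set w | forall i, (0 < i)%N -> X i w <> x]).
  exact: (escape_cvg mc).
have lb : 0 < fine (P [set w | forall i, (0 < i)%N -> X i w <> x]).
  apply: (@lt_le_trans _ _ (1 - step_mean p supp f x / f x)).
    by rewrite subr_gt0 ltr_pdivrMr// mul1r.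
  rewrite -(cvg_lim _ lim)//; apply: limr_ge; first by apply/cvg_ex; eexists;
    exact: lim.
  by near=> n; exact: superharmonic_escape.
have [mX _ _] := mc.
have mr : measurable [set w | exists2 n, (0 < n)%N & X n w = x].
  rewrite (_ : mkset _ = \bigcup_(n in [set n | (0 < n)%N]) (X n @^-1` [set
    x])).
    by apply: bigcup_measurable => n _; exact: mX.
  by apply/seteqP; split=> w [n n0 Xn]; exists n.
move: lb; rewrite (_ : mkset _ = ~` [set w | exists2 n, (0 < n)%N & X n w = x]).
  rewrite probability_setC//.
  have : P [set w | exists2 n, (0 < n)%N & X n w = x] \is a fin_num.
    exact: fin_num_measure.
  by case: (P _) => // a _ /=; rewrite subr_gt0 lte_fin.
apply/seteqP; split=> w /=; first by move=> h [n n0]; exact: h.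
by move=> h i i0 Xi; apply: h; exists i.
Unshelve. all: by end_near. Qed.

End Escape.

(** * Conductances and inverted orbits *)

Section Conductances.
Context (R : realType) (V : countType) (mu : probability (perm_borel V) R).
Context (supp : V -> seq V).
Hypotheses (smu : symmetric_law mu) (usupp : forall x, uniq (supp x))
  (musupp : forall x, mu [set s : perm_borel V | s x \in supp x] = 1%E).

Definition site_transition : V -> V -> R :=
  map_transition mu (fun (s : perm_borel V) x => s x).

Lemma site_transition_sum1 x : \sum_(y <- supp x) site_transition x y = 1.
Proof.
exact: (map_transition_sum1 (@measurable_eval V) usupp musupp).
Qed.

Lemma site_transition_sym x y : site_transition x y = site_transition y x.
Proof.
rewrite /site_transition /map_transition; congr fine.
rewrite (smu (measurable_eval x y)); congr (mu _).
by apply/seteqP; split=> s /= h; rewrite -h;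
  [exact: (Defs.pinvK s)|exact: (pfunK s)].
Qed.

Lemma site_transition_out x y : y \notin supp x -> site_transition x y = 0.
Proof.
move=> ny; apply: EFin_inj.
rewrite (map_transitionE _ (@measurable_eval V)).
apply/eqP; rewrite eq_le measure_ge0 andbT.
have mS : measurable [set s : perm_borel V | s x \in supp x].
  exact: (measurable_eval_in x [set z | z \in supp x]).
apply: (@le_trans _ _ (mu (~` [set s : perm_borel V | s x \in supp x]))).
  apply: le_measure; rewrite ?inE.
  - exact: measurable_eval.
  - exact: measurableC.
  - by move=> s /= ->; exact/negP.
by rewrite probability_setC// musupp subee.
Qed.

(** Symmetry of the law gives C_mu(x, y) = 2 p(x, y) and total conductance 2; normalising returns
    p. *)
Lemma conductance_transitionE x y :
  conductance_transition mu x y = site_transition x y.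
Proof.
have cE z : conductance mu x z = (2 * site_transition x z)%:E.
  rewrite /conductance mulr_natl mulr2n EFinD {2}site_transition_sym.
  by rewrite !(map_transitionE _ (@measurable_eval V)).
have tot : total_conductance mu x =
    (\sum_(z <- supp x) (2 * site_transition x z)%:E)%E.
  rewrite /total_conductance (eq_esum (b := fun z =>
      if z \in [set` supp x] then (2 * site_transition x z)%:E else 0%E)).
    rewrite -esum_mkcond esum_fset; [exact/esym/fsbig_seq|exact: finite_seq|].
    by move=> z _; rewrite lee_fin mulr_ge0// fine_ge0.
  move=> z _; rewrite cE; case: ifPn => //; rewrite notin_setE /= => /negP nz.
  by rewrite site_transition_out ?mulr0.
rewrite /conductance_transition cE tot sumEFin/= -mulr_sumr.
by rewrite site_transition_sum1 mulr1 mulrC mulKf.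
Qed.

End Conductances.

Section Orbits.
Context (V : choiceType) (o : V).
Implicit Types s : nat -> permutation V.

Lemma walk_add s j l x :
  walk s (j + l) x = walk (fun i => s (j + i)%N) l (walk s j x).
Proof. by elim: l => [|l ih]; rewrite ?addn0// addnS /= ih. Qed.

Let preim s j : V := Defs.pinv (walk s j) o.

Lemma inverted_orbit_seq s n :
  inverted_orbit o s n = [set` [fset x in map (preim s) (iota 0 n.+1)]%fset].
Proof.
have memL (L : seq V) x : (x \in [fset y in L]%fset) = (x \in L).
  by rewrite !inE.
move: (memL (map (preim s) (iota 0 n.+1))); set L := map _ _ => {}memL.
apply/seteqP; split=> x /=; rewrite memL.
  move=> [j /= jn wx]; apply/mapP; exists j;
    first by rewrite mem_iota add0n ltnS.
  by rewrite /preim -wx pfunK.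
move=> /mapP[j]; rewrite mem_iota add0n ltnS => /andP[_ jn] ->.
by exists j => //; rewrite /preim/= Defs.pinvK.
Qed.

Lemma card_inverted_orbit_undup s n :
  #|` fset_set (inverted_orbit o s n)| =
  size (undup (map (preim s) (iota 0 n.+1))).
Proof. by rewrite inverted_orbit_seq set_fsetK card_fseq. Qed.

(** [undup] keeps the last occurrence of each value, so its size is the number of indices whose
    value does not recur later. *)
Let size_undup_iota (f : nat -> V) m k :
  size (undup (map f (iota m k))) =
  (\sum_(j < k) (f (m + j) \notin map f (iota (m + j).+1 (k - j.+1))))%N.
Proof.
elim: k m => [|k ih] m; first by rewrite big_ord0.
rewrite big_ord_recl /= addn0 subn1 /=.
under eq_bigr => j _ do rewrite /bump /= add1n addnS -addSn subSS.
by rewrite -ih; case: ifP => //= _; rewrite add0n.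
Qed.

(* j is the last visit time of the particle sitting at o at time j iff the
   walk restarted at time j avoids o; the orbit is counted by last visits. *)
Lemma card_inverted_orbit s n :
  #|` fset_set (inverted_orbit o s n)| =
  (\sum_(j < n.+1) `[< forall i, (0 < i <= n - j)%N ->
     walk (fun i => s (j + i)%N) i o <> o >])%N.
Proof.
rewrite card_inverted_orbit_undup size_undup_iota; apply: eq_bigr => j _.
rewrite add0n subSS; congr nat_of_bool; apply/idP/asboolP.
  (* The points tau_j^-1(o) and tau_(j+i)^-1(o) coincide exactly when the walk restarted at time j
     is at [o] after i steps. *)
  move=> /mapP h i /andP[i0 ij] wo; apply: h; exists (j + i)%N.
    by rewrite mem_iota addSn ltnS leq_add2l ij andbT -[X in (X < _)%N]addn0
      ltn_add2l.
  apply: (can_inj (pfunK (walk s (j + i)%N))).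
  by rewrite Defs.pinvK walk_add [walk s j _](Defs.pinvK (walk s j)).
move=> h; apply/mapP => -[k]; rewrite mem_iota => /andP[jk kn] e.
have := h (k - j)%N; rewrite subn_gt0 jk /=.
have -> : (k - j <= n - j)%N.
  by rewrite leq_sub2r//; move: kn; rewrite addSn ltnS subnKC// -ltnS.
move=> /(_ isT); apply.
have := walk_add s j (k - j) (preim s j); rewrite subnKC ?(ltnW jk)//.
by rewrite [walk s j _](Defs.pinvK (walk s j)) e [walk s k _](Defs.pinvK (walk
  s k)).
Qed.

(** Removal precedes the move, so a particle that reaches [o] is still in the list at that time and
    is counted there exactly once. *)
Definition kill_step (t : permutation V) (Y : seq V) : seq V :=
  map t [seq y <- Y | y != o].

Let alive s k (x : V) : bool := all (fun j => walk s j x != o) (iota 0 k).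

Let aliveS s k x : alive s k.+1 x = alive s k x && (walk s k x != o).
Proof. by rewrite /alive -addn1 iotaD all_cat /= andbT. Qed.

Lemma kill_chainE (F : seq V) s k :
  map_chain kill_step F s k = map (walk s k) [seq x <- F | alive s k x].
Proof.
elim: k => [|k ih] /=.
  by rewrite (eq_filter (a2 := predT)) ?filter_predT ?map_id.
rewrite ih /kill_step filter_map -map_comp -filter_predI.
by congr map; apply: eq_filter => x /=; rewrite aliveS andbC.
Qed.

(** Each particle is counted at its first visit to [o] only, so the sum is the number of starting
    points in [F] that hit [o] by time n; all of them lie in the inverted orbit. *)
Lemma kill_chain_count (F : seq V) s n : uniq F ->
  (\sum_(k < n.+1) count_mem o (map_chain kill_step F s k) <=
   #|` fset_set (inverted_orbit o s n)|)%N.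
Proof.
move=> uF.
have -> : (\sum_(k < n.+1) count_mem o (map_chain kill_step F s k) =
    count (predC (alive s n.+1)) F)%N.
  elim: n.+1 => {n} [|n ih];
    first by rewrite big_ord0 (eq_count (a2 := pred0)) ?count_pred0.
  rewrite big_ord_recr/= ih kill_chainE count_map count_filter.
  rewrite -count_predUI [X in (_ + X)%N](eq_count (a2 := pred0)) ?count_pred0
    ?addn0.
    by apply: eq_count => x /=; rewrite aliveS negb_and; case: alive;
      rewrite ?negbK ?orbF ?andbT// andbF.
  by move=> x /=; case: alive; rewrite ?andbF.
rewrite card_inverted_orbit_undup -size_filter.
have inL x j : j \in iota 0 n.+1 -> walk s j x = o ->
    x \in undup (map (preim s) (iota 0 n.+1)).
  by move=> jn wx; rewrite mem_undup; apply/mapP; exists j;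
    rewrite // /preim -wx pfunK.
apply: uniq_leq_size; first exact: filter_uniq.
move=> x; rewrite mem_filter => /andP[+ _] => /allPn[j jn /negPn/eqP wx].
exact: inL jn wx.
Qed.

End Orbits.

(** * Negative dependence and killed walks *)

Section HittingProbabilities.
Context (R : realType) (V : choiceType) (p : V -> V -> R) (supp : V -> seq V).
Hypotheses (p0 : forall x y, 0 <= p x y) (usupp : forall z, uniq (supp z))
  (psupp : forall z, \sum_(y <- supp z) p z y = 1)
  (pC : forall x y, p x y = p y x)
  (pout : forall x y, y \notin supp x -> p x y = 0).
Context (o : V).

(** First-step recursion for the probability of visiting [o] at some time 0, ..., n from x, that is,
    of x lying in O_n. *)
Fixpoint hitting (n : nat) (x : V) : R :=
  if n is m.+1 then if x == o then 1 else step_mean p supp (hitting m) x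
  else (x == o)%:R.

Lemma hitting_ge0 n x : 0 <= hitting n x.
Proof.
elim: n x => [|n ih] x //=; case: ifP => // _; exact: step_mean_ge0.
Qed.

Lemma hitting_escape n z : 1 - hitting n z = (z != o)%:R * escape p supp o n z.
Proof.
elim: n z => [|n ih] z; first by rewrite mulr1 /=; case: eqP => _;
  rewrite ?subrr ?subr0.
rewrite [LHS]/=; have [_|_] := eqVneq z o; first by rewrite subrr mul0r.
rewrite mul1r -{1}(psupp z) /escape /= /step_mean -sumrB.
by apply: eq_bigr => y _; rewrite -ih mulrBr mulr1.
Qed.

Lemma hitting_le1 n x : hitting n x <= 1.
Proof.
elim: n x => [|n ih] x /=; first by case: eqP.
case: ifP => // _; rewrite -(psupp x) /step_mean; apply: ler_sum => y _.
by rewrite -[leRHS]mulr1 ler_wpM2l.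
Qed.

(** The sites reachable from [o] in at most n steps. As p is symmetric, only these can hit [o] by
    time n with positive probability, so finite lists replace sums over [V]. *)
Fixpoint hitting_support (n : nat) : seq V :=
  if n is m.+1 then o :: flatten (map supp (hitting_support m)) else [:: o].

(* First-step analysis: summing the hitting probabilities over all starting
   points, each step adds exactly one escape probability, because p is
   doubly stochastic. *)
Lemma sum_hitting_ge n (F : seq V) : uniq F ->
  {subset hitting_support n <= F} ->
  \sum_(j < n.+1) escape p supp o j o <= \sum_(x <- F) hitting n x.
Proof.
elim: n F => [|n ih] F uF sF.
  rewrite big_ord1 (bigD1_seq o)//=; last by apply: sF; rewrite inE.
  by rewrite eqxx lerDl sumr_ge0.
have oF : o \in F by apply: sF; rewrite /= inE eqxx.
rewrite big_ord_recr /= (bigD1_seq o)//= eqxx.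
(* [hitting n.+1] differs from the one-step mean of [hitting n] only at [o], and there by this
   escape probability. *)
have -> : escape p supp o n.+1 o = 1 - step_mean p supp (hitting n) o.
  rewrite -{1}(psupp o) /escape /= /step_mean -sumrB; apply: eq_bigr => y _.
  by rewrite -hitting_escape mulrBr mulr1.
rewrite addrCA lerD2l lerBlDr.
rewrite (eq_bigr (step_mean p supp (hitting n))); last first.
  by move=> x /negbTE ->.
rewrite addrC -(bigD1_seq o oF uF (F := step_mean p supp (hitting n))) /=.
pose G := undup (hitting_support n).
have uG : uniq G by exact: undup_uniq.
apply: (le_trans (ih G uG _)); first by move=> x; rewrite mem_undup.
have mean_ge x : \sum_(y <- G) p x y * hitting n y <= step_mean p supp (hitting
  n) x.
  rewrite (bigID (mem (supp x)))/= [X in _ + X]big1 ?addr0; last first.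
    by move=> y /pout ->; rewrite mul0r.
  rewrite -big_filter /step_mean [leRHS](bigID (mem G))/=.
  rewrite -[X in _ <= X + _]big_filter.
  rewrite (perm_big [seq y <- supp x | y \in G]) ?lerDl ?sumr_ge0//.
    by move=> y _; rewrite mulr_ge0// hitting_ge0.
  apply: uniq_perm; rewrite ?filter_uniq// => y.
  by rewrite !mem_filter andbC.
apply: (@le_trans _ _ (\sum_(x <- F) \sum_(y <- G) p x y * hitting n y));
  last first.
  by apply: ler_sum => x _; exact: mean_ge.
rewrite exchange_big/= !big_seq; apply: ler_sum => y yG.
(* Symmetry turns the column sum of p at y into a row sum, which is at least 1 because [F] contains
   [supp y]. *)
rewrite -mulr_suml ler_peMl ?hitting_ge0// -(psupp y).
have yF : {subset supp y <= F}.
  move=> x xy; apply: sF; rewrite /= inE; apply/orP; right.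
  by apply/flattenP; exists (supp y) => //; apply: map_f; rewrite -mem_undup.
rewrite [leRHS](bigID (mem (supp y)))/= -[X in _ <= X + _]big_filter.
rewrite [X in _ <= X + _](perm_big (supp y)); last first.
  apply: uniq_perm; rewrite ?filter_uniq// => x; rewrite mem_filter.
  by apply/idP/idP => [/andP[]//|xy]; apply/andP; split=> //; exact: yF.
rewrite /= [X in _ <= X + _](eq_bigr (p y)); last by move=> i _; exact: pC.
by rewrite lerDl sumr_ge0.
Qed.

End HittingProbabilities.

Section KilledWalks.
Context (R : realType) (V : countType) (o : V).
Context (mu : probability (perm_borel V) R) (supp : V -> seq V).
Hypotheses (usupp : forall x, uniq (supp x))
  (musupp : forall x, mu [set s : perm_borel V | s x \in supp x] = 1%E).
Let p : V -> V -> R := site_transition mu.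
Hypothesis nd : forall h : V -> R, (forall x, 0 <= h x) ->
  forall Y, uniq Y -> (\int[mu]_s (\prod_(x <- Y) h (s x))%:E <=
    (\prod_(x <- Y) step_mean p supp h x)%:E)%E.

Fixpoint list_support (Y : seq V) : seq (seq V) :=
  if Y is y :: Y' then [seq z :: Z | z <- supp y, Z <- list_support Y']
  else [:: [::]].

Lemma uniq_list_support Y : uniq (list_support Y).
Proof.
elim: Y => //= y Y ih; apply: allpairs_uniq => //.
by move=> [z Z] [z' Z'] _ _ /= [-> ->].
Qed.

Lemma mem_list_support (t : V -> V) Y :
  (forall y, y \in Y -> t y \in supp y) -> map t Y \in list_support Y.
Proof.
elim: Y => //= y Y ih h; apply: allpairs_f; first by apply: h; rewrite mem_head.
by apply: ih => z zY; apply: h; rewrite inE zY orbT.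
Qed.

Let killed (t : perm_borel V) (Y : seq V) : seq V := kill_step o t Y.

Let mkilled Y Z : measurable [set t | killed t Y = Z].
Proof. exact: measurable_map_eq. Qed.

Let killsupp (Y : seq V) := list_support [seq y <- Y | y != o].

Let killsuppP Y : mu [set t | killed t Y \in killsupp Y] = 1%E.
Proof.
rewrite /killed /kill_step /killsupp; set Z := [seq _ <- Y | _].
have mZ (W : seq V) : measurable [set t : perm_borel V | forall y, y \in W -> t
  y \in supp y]
  /\ mu [set t : perm_borel V | forall y, y \in W -> t y \in supp y] = 1%E.
  elim: W => [|z W [mW PW]].
    rewrite (_ : mkset _ = setT); last by apply/seteqP; split.
    by rewrite probability_setT.
  rewrite (_ : mkset _ = [set t : perm_borel V | t z \in supp z] `&`
    [set t : perm_borel V | forall y, y \in W -> t y \in supp y]).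
    have mz : measurable [set t : perm_borel V | t z \in supp z].
      exact: (measurable_eval_in z [set v | v \in supp z]).
    rewrite probability_setI1//; split; last exact: musupp.
    exact: measurableI.
  apply/seteqP; split=> t /=.
    by move=> h; split=> [|y yW]; apply: h; rewrite inE ?eqxx// yW orbT.
  by move=> [h1 h2] y; rewrite inE => /predU1P[->//|]; exact: h2.
have mL : measurable [set t : perm_borel V | map t Z \in list_support Z].
  exact: (measurable_map_in Z [set v | v \in list_support Z]).
apply/eqP; rewrite eq_le probability_le1//= -(mZ Z).2.
by apply: le_measure; rewrite ?inE//; [exact: (mZ Z).1|move=> t /=;
  exact: mem_list_support].
Qed.

Let q : seq V -> seq V -> R := map_transition mu killed.
Let half (Y : seq V) : R := 2^-1 ^+ count_mem o Y.

(** A particle at [o] contributes 1/2 = 1 - 1/2, its hitting probability being 1, and leaves. For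
    the others the dependence inequality is applied to h = 1 - hitting n / 2, whose one-step mean is
    1 - hitting n.+1 / 2 away from [o]. *)
Lemma killed_weight_le n Y : uniq Y ->
  half Y * path_weight q killsupp half n Y <=
  \prod_(x <- Y) (1 - hitting p supp o n x / 2).
Proof.
have p1 := site_transition_sum1 usupp musupp.
have hitE m (x : V) : step_mean p supp (fun y => 1 - hitting p supp o m y / 2)
  x =
    1 - step_mean p supp (hitting p supp o m) x / 2.
  rewrite -[X in _ = X - _](p1 x) /step_mean mulr_suml -sumrB;
    apply: eq_bigr => y _.
  by rewrite mulrBr mulr1 mulrA.
have h0 m x : 0 <= 1 - hitting p supp o m x / 2.
  by have := hitting_le1 (fun x y => map_transition_ge0 mu _ x y) p1 o m x; lra.
have halfE Y' : half Y' = \prod_(x <- Y') (if x == o then 2^-1 else 1).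
  rewrite /half; elim: Y' => [|y Y' ih]; first by rewrite big_nil expr0.
  by rewrite /= exprD big_cons ih; case: eqP => _; rewrite ?expr1 ?expr0.
elim: n Y => [|n ih] Y uY.
  rewrite /= mulr1 halfE; apply: ler_prod => x _.
  by case: eqP => _ /=; rewrite ?mul0r ?subr0 ?invr_ge0 ?ler01 ?ler0n//=; lra.
apply: (@le_trans _ _ (half Y * step_mean q killsupp
    (fun Z => \prod_(z <- Z) (1 - hitting p supp o n z / 2)) Y)).
  rewrite ler_wpM2l ?exprn_ge0//= /step_mean; apply: ler_sum => Z _.
  (* The induction hypothesis covers lists without repetition; the others carry no mass since
     permutations are injective. *)
  have [uZ|nuZ] := boolP (uniq Z).
    by rewrite ler_wpM2l ?ih//; exact: fine_ge0.
  rewrite (_ : q Y Z = 0) ?mul0r//; apply: EFin_inj.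
  rewrite (map_transitionE _ mkilled) [X in mu X](_ : _ = set0) ?measure0//.
  apply/seteqP; split=> // t /= tZ; move: nuZ; rewrite -tZ /killed /kill_step.
  rewrite map_inj_uniq ?filter_uniq//; exact: (can_inj (pfunK t)).
have key : step_mean q killsupp
    (fun Z => \prod_(z <- Z) (1 - hitting p supp o n z / 2)) Y <=
    \prod_(x <- Y | x != o) (1 - step_mean p supp (hitting p supp o n) x / 2).
  rewrite -lee_fin -(integral_act mkilled _ killsuppP); last 2 first.
  - by move=> y; exact: uniq_list_support.
  - by move=> Z; rewrite prodr_ge0.
  under eq_integral do rewrite /killed /kill_step big_map.
  apply: le_trans (nd (h0 n) (filter_uniq (fun x => x != o) uY)) _.
  by rewrite lee_fin big_filter (eq_bigr _ (fun x _ => hitE n x)).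
apply: le_trans (ler_wpM2l _ key) _; first by rewrite exprn_ge0.
rewrite halfE [X in _ * X]big_mkcond -big_split/=; apply: ler_prod => x _.
have := h0 n.+1 x; rewrite /=.
by case: eqP => _ /= h; apply/andP; split; move: h; lra.
Qed.

Lemma measurable_half_visits dO (Om : measurableType dO)
    (P : probability Om R) (s : nat -> {mfun Om >-> perm_borel V}) n (F : seq
      V) :
  iid_law P mu s ->
  measurable_fun setT (fun w => (2^-1 : R) ^+ (\sum_(k < n)
     count_mem o (map_chain (kill_step o) F (fun i => s i w) k))).
Proof.
move=> iid; have [mY _ _] := iid_markov_chain mkilled F iid.
under eq_fun do rewrite -prodrXr.
apply: measurable_prod => k _.
apply: (@measurable_countable_comp _ _ _ _ _ _ half) => Z.
exact: (mY k [set Z]).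
Qed.

Lemma integral_half_visits dO (Om : measurableType dO) (P : probability Om R)
    (s : nat -> {mfun Om >-> perm_borel V}) n (F : seq V) :
  iid_law P mu s -> uniq F ->
  (\int[P]_w ((2^-1 : R) ^+ (\sum_(k < n.+1)
     count_mem o (map_chain (kill_step o) F (fun i => s i w) k)))%:E <=
   (\prod_(x <- F) (1 - hitting p supp o n x / 2))%:E)%E.
Proof.
move=> iid uF; pose Y k w := map_chain killed F (fun i => s i w) k.
have mc : markov_chain q F P Y := iid_markov_chain mkilled F iid.
have [mY _ _] := mc.
apply: (@le_trans _ _ (half F * path_weight q killsupp half n F)%:E);
  last first.
  by rewrite lee_fin; exact: killed_weight_le.
have qsum1 : forall Z, \sum_(z <- killsupp Z) q Z z = 1.
  by move=> Z; apply: map_transition_sum1 => // y; exact: uniq_list_support.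
have ukill Z : uniq (killsupp Z) by exact: uniq_list_support.
have half0 Z : 0 <= half Z by rewrite exprn_ge0.
rewrite EFinM -(markov_chain_path_weight ukill qsum1 mc)//.
rewrite -ge0_integralZl_EFin//; last 2 first.
- by move=> w _; rewrite lee_fin prodr_ge0.
- apply/measurable_EFinP; apply: measurable_prod => k _.
  by apply: measurable_countable_comp => Z; exact: (mY k.+1 [set Z]).
rewrite le_eqVlt; apply/orP; left; apply/eqP.
apply: eq_integral => w _; rewrite -EFinM; congr (_%:E).
by rewrite -prodrXr big_ord_recl.
Qed.

End KilledWalks.

(** * Bounds on the inverted orbit *)

Lemma return_timeE (R : realType) (V : Type) (o : V) (s : nat -> permutation V)
  :
  return_time R o s = +oo%E <-> forall i, (0 < i)%N -> walk s i o <> o.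
Proof.
split=> [h i i0 wo|h].
  have : (return_time R o s <= i%:R%:E)%E by apply: ereal_inf_lbound; exists i.
  by rewrite h leye_eq.
rewrite /return_time (_ : [set _ | _ in _] = set0) ?ereal_inf0//.
by apply/seteqP; split=> // x [n [n0 wn] _]; exact: h wn.
Qed.

Section OrbitBounds.
Context (R : realType) (V : countType) (o : V).
Context (mu : probability (perm_borel V) R) (supp : V -> seq V).
Hypotheses (smu : symmetric_law mu) (usupp : forall x, uniq (supp x))
  (musupp : forall x, mu [set s : perm_borel V | s x \in supp x] = 1%E).
Let p : V -> V -> R := site_transition mu.
Hypothesis nd : forall h : V -> R, (forall x, 0 <= h x) ->
  forall Y, uniq Y -> (\int[mu]_s (\prod_(x <- Y) h (s x))%:E <=
    (\prod_(x <- Y) step_mean p supp h x)%:E)%E.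
Context dO (Om : measurableType dO) (P : probability Om R).

Lemma walk_markov_chain (s : nat -> {mfun Om >-> perm_borel V}) x :
  iid_law P mu s -> markov_chain p x P (fun n w => walk (fun i => s i w) n x).
Proof.
move=> iid; have := iid_markov_chain (@measurable_eval V) x iid.
rewrite (_ : (fun n w => map_chain _ x _ n) =
  (fun n w => walk (fun i => s i w) n x))//.
by apply/funext => n; apply/funext => w; elim: n => //= n ->.
Qed.

Context (s : nat -> {mfun Om >-> perm_borel V}).
Hypothesis iid : iid_law P mu s.

Let p0 x y : 0 <= p x y. Proof. exact: map_transition_ge0. Qed.
Let psupp : forall x, \sum_(y <- supp x) p x y = 1.
Proof. exact: site_transition_sum1. Qed.
Let mc := walk_markov_chain o iid.

Let card n w : nat := #|` fset_set (inverted_orbit o (fun i => s i w) n)|.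
Let esc n : R := escape p supp o n o.
Let avoid n j : set Om := [set w | forall i, (0 < i <= n - j)%N ->
  walk (fun i => s (j + i)%N w) i o <> o].
Let total n : R := \sum_(j < n.+1) esc j.

Let mavoid n j : measurable (avoid n j).
Proof. exact: (measurable_avoid (walk_markov_chain o (iid_law_shift j iid))).
  Qed.

Let cardE n w : (card n w)%:R = \sum_(j < n.+1) (\1_(avoid n j) w : R).
Proof.
rewrite /card card_inverted_orbit natr_sum; apply: eq_bigr => j _.
by rewrite indicE.
Qed.

Let mcard n : measurable_fun setT (fun w => (card n w)%:R : R).
Proof.
rewrite (_ : (fun w => _) = fun w => \sum_(j < n.+1) (\1_(avoid n j) w : R)).
  by apply: measurable_sum => j; exact: measurable_indic.
by apply/funext => w; rewrite cardE.
Qed.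

Let mcard_fun n (f : nat -> R) : measurable_fun setT (fun w => f (card n w)).
Proof.
apply: measurable_countable_comp => k.
rewrite (_ : mkset _ = (fun w => (card n w)%:R : R) @^-1` [set k%:R]).
  by rewrite -[X in measurable X]setTI; apply: mcard.
apply/seteqP; split=> w /=; first by move=> ->.
by move=> /eqP; rewrite eqr_nat => /eqP.
Qed.

(** The walk restarted at time j has the same law, so [avoid n j] has probability [esc (n - j)];
    reversing the index gives [total n]. *)
Let integral_card n : (\int[P]_w ((card n w)%:R)%:E = (total n)%:E)%E.
Proof.
rewrite (eq_integral (fun w => \sum_(j < n.+1) (\1_(avoid n j) w)%:E)%E);
  last first.
  by move=> w _; rewrite cardE -sumEFin.
rewrite ge0_integral_sum//; last first.
  by move=> j; apply/measurable_EFinP; exact: measurable_indic.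
rewrite /total -sumEFin [RHS](reindex_inj rev_ord_inj)/=.
apply: eq_bigr => j _; rewrite integral_indic// setIT subSS.
exact: (probability_escape usupp psupp (walk_markov_chain o (iid_law_shift j
  iid))).
Qed.

Let pT : R := fine (P [set w | return_time R o (fun i => s i w) = +oo%E]).

Let pTE : pT =
  fine (P [set w | forall i, (0 < i)%N -> walk (fun i => s i w) i o <> o]).
Proof.
by congr (fine (P _)); apply/seteqP; split=> w /=; rewrite return_timeE.
Qed.

Lemma orbit_lower_bound n :
  ((expR (- (ln 2 * total n)))%:E <= \int[P]_w (2^-1 ^+ card n w)%:E)%E.
Proof.
set c := expR _; have c0 : 0 < c by exact: expR_gt0.
have ln20 : 0 <= ln (2 : R) by rewrite ln_ge0// ler1n.
have t0 : 0 <= total n.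
  rewrite -lee_fin -integral_card; apply: integral_ge0 => w _.
  by rewrite lee_fin.
(* Jensen's inequality through its supporting line: 2^-k lies above its tangent at [total n],
   because e^y >= 1 + y. The mean of the linear part is then known exactly. *)
have pw k : c * (1 + ln 2 * total n) <= 2^-1 ^+ k + c * ln 2 * k%:R.
  have -> : 2^-1 ^+ k = c * expR (- ln 2 * k%:R + ln 2 * total n).
    rewrite /c -expRD addrCA addNr addr0.
    by rewrite expRM_natr expRN lnK// posrE.
  have := expR_ge1Dx (- ln 2 * k%:R + ln 2 * total n).
  rewrite -(ler_pM2l c0); lra.
have key : ((c * (1 + ln 2 * total n))%:E <=
    \int[P]_w (2^-1 ^+ card n w)%:E + (c * ln 2 * total n)%:E)%E.
  rewrite [X in (_ <= _ + X)%E]EFinM -integral_card.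
  rewrite -ge0_integralZl_EFin//; last 2 first.
  - by apply/measurable_EFinP; exact: mcard.
  - by rewrite mulr_ge0// ltW.
  rewrite -ge0_integralD; last 5 first.
  - by [].
  - by move=> w _; rewrite lee_fin exprn_ge0.
  - by apply/measurable_EFinP; exact: mcard_fun.
  - by move=> w _; rewrite lee_fin !mulr_ge0// ltW.
  - by apply/measurable_EFinP; apply: (mcard_fun n (fun k => c * ln 2 * k%:R)).
  rewrite -[leLHS]mule1 -(probability_setT P) -integral_cst//.
  apply: ge0_le_integral => //.
  - by move=> w _; rewrite /= lee_fin mulr_ge0 ?addr_ge0 ?mulr_ge0// ltW.
  - by apply/measurable_EFinP;
    apply: (mcard_fun n (fun k => 2^-1 ^+ k + c * ln 2 * k%:R)).
  - by move=> w _; rewrite -EFinM -EFinD lee_fin.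
rewrite -leeBlDr// -EFinB in key; apply: le_trans key.
by rewrite lee_fin; lra.
Qed.

Let total_ge n : n.+1%:R * pT <= total n.
Proof.
rewrite mulr_natl -[X in _ *+ X]card_ord -sumr_const; apply: ler_sum => j _.
by rewrite pTE; exact: (escape_ge usupp psupp mc).
Qed.

(** Restricting to particles that start in the finite list [F] only lowers the count, while [F] is
    large enough for the hitting probabilities to sum to at least [total n]. *)
Lemma orbit_upper_bound n :
  (\int[P]_w (2^-1 ^+ card n w)%:E <= (expR (- (n.+1%:R / 2 * pT)))%:E)%E.
Proof.
pose F := undup (hitting_support supp o n).
have uF : uniq F by exact: undup_uniq.
have sF : {subset hitting_support supp o n <= F} by move=> x; rewrite mem_undup.
have sumF := sum_hitting_ge p0 usupp psupp (site_transition_sym smu)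
  (fun x y => site_transition_out musupp (x:=x) (y:=y)) uF sF.
apply: (@le_trans _ _ (\prod_(x <- F) (1 - hitting p supp o n x / 2))%:E).
  apply: le_trans (integral_half_visits o usupp musupp nd n iid uF).
  apply: ge0_le_integral => //.
  - by apply/measurable_EFinP; exact: mcard_fun.
  - apply/measurable_EFinP; exact: (measurable_half_visits _ _ _ iid).
  - move=> w _; rewrite lee_fin ler_wiXn2l ?invr_ge0 ?invf_le1 ?ler1n//.
    exact: kill_chain_count.
rewrite lee_fin; apply: (@le_trans _ _ (expR (\sum_(x <- F) (- (hitting p supp
  o n x / 2))))).
  rewrite expR_sum; apply: ler_prod => x _.
  rewrite expR_ge1Dx andbT subr_ge0.
  have := hitting_le1 p0 psupp o n x; lra.
rewrite ler_expR sumrN lerN2 -mulr_suml.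
have := total_ge n; rewrite /total /esc; lra.
Qed.

Lemma orbit_error_littleo :
  (fun n => - (ln 2 * (total n - n%:R * pT))) =o_\oo (fun n => n%:R : R).
Proof.
have lim : arithmetic_mean esc @ \oo --> pT.
  by apply: cesaro; rewrite pTE; exact: (escape_cvg usupp psupp mc).
apply/eqoP => e e0.
have ln20 : 0 < ln (2 : R) by rewrite ln_gt0// ltr1n.
have pT1 : 0 <= pT <= 1.
  rewrite fine_ge0//= pTE.
  exact: (escape_ge usupp psupp mc o 0).
(* Once n >= 1 and n d >= 1, the bound (n + 1) d + 1 reached below is at most 4 n d = n e / ln 2. *)
pose d := e / (4 * ln 2).
have d0 : 0 < d by rewrite divr_gt0// mulr_gt0.
have /cvgrPdist_le/(_ _ d0) near1 := lim.
near=> n.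
have n1 : (1 <= n)%N by near: n; exists 1%N.
have n2 : d^-1 <= n%:R by near: n; exact: nbhs_infty_ger.
have : `|pT - arithmetic_mean esc n| <= d by near: n; exact: near1.
have -> : arithmetic_mean esc n = n.+1%:R^-1 * total n.
  by rewrite /arithmetic_mean/= /series/= big_mkord.
rewrite normrN normrM gtr0_norm// (ger0_norm (ler0n R n)) => h.
have h2 : `|n.+1%:R * pT - total n| <= n.+1%:R * d.
  rewrite -[total n](mulVKf (_ : n.+1%:R != 0 :> R)) ?pnatr_eq0//.
  by rewrite -mulrBr normrM ger0_norm// ler_wpM2l.
(* The Cesaro mean has n + 1 terms while the claim has n; the discrepancy is one [pT], at most 1. *)
have h3 : `|total n - n%:R * pT| <= n.+1%:R * d + 1.
  rewrite (_ : total n - n%:R * pT = - (n.+1%:R * pT - total n) + pT);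
    last first.
    by rewrite -natr1; lra.
  apply: le_trans (ler_normD _ _) _; rewrite normrN lerD// ger0_norm; lra.
apply: (@le_trans _ _ (ln 2 * (n.+1%:R * d + 1))).
  by rewrite ler_wpM2l// ltW.
have nn : (1 : R) <= n%:R by rewrite ler1n.
have dn : 1 <= n%:R * d by rewrite -ler_pdivrMr// div1r.
have -> : e = ln 2 * (4 * d).
  by rewrite /d [RHS]mulrA [ln 2 * 4]mulrC [RHS]mulrC divfK// gt_eqF// mulr_gt0.
rewrite -[leRHS]mulrA ler_wpM2l ?ltW// -natr1; nra.
Unshelve. all: by end_near. Qed.

End OrbitBounds.

(** * A superharmonic function on R^3 *)

Section InverseFourthRoot.
Context (R : rcfType).
Implicit Types r s u : R.

Definition inv_root4 r : R := (Num.sqrt (Num.sqrt r))^-1.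

Lemma inv_root4_gt0 r : 0 < r -> 0 < inv_root4 r.
Proof. by move=> r0; rewrite invr_gt0 !sqrtr_gt0. Qed.

Lemma inv_root4X r : 0 < r -> inv_root4 r ^+ 4 = r^-1.
Proof.
move=> r0; rewrite /inv_root4 exprVn (exprM _ 2 2).
by rewrite !sqr_sqrtr// ?sqrtr_ge0// ltW.
Qed.

(** The polynomial dominates (1 + u)^(-1/4): the Taylor coefficient 5/32 of u^2 is rounded up to
    6/32 to absorb the higher terms on this interval. *)
Lemma root4_poly_bound u : `|u| <= 20^-1 ->
  1 <= (1 - u / 4 + 3 / 16 * u ^+ 2) ^+ 4 * (1 + u).
Proof.
rewrite ler_norml => /andP[u1 u2].
set p := 1 - u / 4 + 3 / 16 * u ^+ 2.
have u2_ge0 := sqr_ge0 u.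
(* The exact u^2 coefficient is 28/64 here and 35/32 after the next squaring; lowering them to 27/64
   and 34/32 pays for the cubic and quartic terms. *)
have p2 : 1 - u / 2 + 27 / 64 * u ^+ 2 <= p ^+ 2.
  have -> : p ^+ 2 = 1 - u / 2 + 27 / 64 * u ^+ 2 +
      u ^+ 2 * (1 / 64 - 3 / 32 * u + (3 / 16) ^+ 2 * u ^+ 2).
    by rewrite /p; lra.
  by rewrite lerDl mulr_ge0//; lra.
have p4 : 1 - u + 17 / 16 * u ^+ 2 <= p ^+ 4.
  apply: (@le_trans _ _ ((1 - u / 2 + 27 / 64 * u ^+ 2) ^+ 2)).
    have -> : (1 - u / 2 + 27 / 64 * u ^+ 2) ^+ 2 = 1 - u + 17 / 16 * u ^+ 2 +
        u ^+ 2 * (1 / 32 - 27 / 64 * u + (27 / 64) ^+ 2 * u ^+ 2) by lra.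
    by rewrite lerDl mulr_ge0//; lra.
  by rewrite (exprM _ 2 2) lerXn2r// nnegrE ?sqr_ge0//; lra.
apply: (@le_trans _ _ ((1 - u + 17 / 16 * u ^+ 2) * (1 + u))); last first.
  by rewrite ler_wpM2r//; lra.
have -> : (1 - u + 17 / 16 * u ^+ 2) * (1 + u) =
    1 + u ^+ 2 * (1 / 16 + 17 / 16 * u) by lra.
by rewrite lerDl mulr_ge0//; lra.
Qed.

Lemma inv_root4_bound r s : 0 < r -> `|s| <= r / 20 ->
  inv_root4 (r + s) <=
  inv_root4 r * (1 - s / r / 4 + 3 / 16 * (s / r) ^+ 2).
Proof.
move=> r0 sr; pose u := s / r.
have su : s = r * u by rewrite /u mulrC divfK// gt_eqF.
have u20 : `|u| <= 20^-1.
  by rewrite /u normrM normfV (gtr0_norm r0) ler_pdivrMr// mulrC.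
have u0 : 0 < 1 + u by move: u20; rewrite ler_norml; lra.
have rs0 : 0 < r + s by rewrite su -[X in X + _]mulr1 -mulrDr mulr_gt0.
have q0 : 0 <= 1 - u / 4 + 3 / 16 * u ^+ 2.
  by move: u20; rewrite ler_norml; have := sqr_ge0 u; lra.
rewrite -/u -(@ler_pXn2r _ 4)// ?nnegrE; last 2 first.
- by rewrite ltW// inv_root4_gt0.
- by rewrite mulr_ge0// ltW// inv_root4_gt0.
rewrite exprMn !inv_root4X// su -[X in (X + _)^-1]mulr1 -mulrDr invfM.
rewrite ler_pM2l ?invr_gt0//.
by rewrite -[leLHS]mul1r ler_pdivrMr// root4_poly_bound.
Qed.

End InverseFourthRoot.

Section Superharmonic.
Context (R : rcfType).
Implicit Types a b c : R.

(* The quadratic form below is the inverse, up to scaling, of the covariance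
   matrix of the walk with steps t_i - t_j, which makes its power -1/4 behave
   like |x|^(-1/2) in R^3. The constant only needs to be large. *)
Definition form_shift : R := 30 ^+ 2.

Definition shifted_form a b c : R :=
  form_shift + (a ^+ 2 + b ^+ 2 + c ^+ 2 + (a + b + c) ^+ 2).

Definition harmonic_bump a b c : R := inv_root4 (shifted_form a b c).

Let form_shiftE : form_shift = 30 * 30. Proof. by rewrite /form_shift expr2.
  Qed.

Let formE a b c : shifted_form a b c =
  form_shift + (a ^+ 2 + b ^+ 2 + c ^+ 2 + (a + b + c) ^+ 2).
Proof. by []. Qed.

Lemma shifted_form_ge a b c : form_shift <= shifted_form a b c.
Proof. by rewrite lerDl !addr_ge0// sqr_ge0. Qed.

Lemma shifted_form_gt0 a b c : 0 < shifted_form a b c.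
Proof. by apply: lt_le_trans (shifted_form_ge a b c);
  rewrite exprn_gt0// ltr0n. Qed.

Lemma harmonic_bump_gt0 a b c : 0 < harmonic_bump a b c.
Proof. exact/inv_root4_gt0/shifted_form_gt0. Qed.

(** Opposite steps are paired so that the terms linear in x cancel. Here x stands for the form
    paired with the step, and the hypothesis is Cauchy-Schwarz for a step of form value 2. *)
Let pair_bound r x : form_shift <= r -> x ^+ 2 <= 2 * (r - form_shift) ->
  inv_root4 (r + (2 * x + 2)) + inv_root4 (r + (- 2 * x + 2)) <=
  inv_root4 r * (2 - 1 / r + 3 / 16 * ((8 * x ^+ 2 + 8) / r ^+ 2)).
Proof.
have := form_shiftE; move: form_shift => K KE r1 xr.
have r0 : 0 < r by lra.
have h (e : R) : e ^+ 2 = 1 -> `|2 * (e * x) + 2| <= r / 20.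
  move=> e1; set y := e * x.
  have y2 : y ^+ 2 <= 2 * (r - K) by rewrite /y exprMn e1 mul1r.
  (* These give |2 y| <= y^2 / 40 + 40 <= (r - K) / 20 + 40, so |2 y + 2| <= r / 20 as soon as K /
     20 >= 42; here K / 20 = 45. *)
  have := sqr_ge0 (y - 40); have := sqr_ge0 (y + 40) => h1 h2.
  by rewrite ler_norml; apply/andP; split; lra.
have := inv_root4_bound r0 (h 1 (expr1n _ _)).
have := inv_root4_bound r0 (h (- 1) (sqrr_sign _ 1)).
rewrite mul1r (_ : 2 * (- 1 * x) = - 2 * x); last by lra.
move=> h1 h2; apply: le_trans (lerD h2 h1) _.
rewrite -mulrDr ler_wpM2l ?(ltW (inv_root4_gt0 r0))//.
rewrite !exprMn !exprVn; set i := r^-1; set j := (r ^+ 2)^-1.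
lra.
Qed.

(** Four of the sixteen steps vanish. The others are the roots of A_3, all of form value 2, and over
    the six opposite pairs the squared products with a point sum to 4 times its form. With the
    coefficient 3/16 the terms in 1/r cancel exactly, and strictness comes from the shift K, in
    [gap]. *)
Lemma harmonic_bump_mean a b c (f := harmonic_bump) :
  4 * f a b c +
  (f (a + 1) b c + f (a - 1) b c) + (f a (b + 1) c + f a (b - 1) c) +
  (f a b (c + 1) + f a b (c - 1)) +
  (f (a + 1) (b - 1) c + f (a - 1) (b + 1) c) +
  (f (a + 1) b (c - 1) + f (a - 1) b (c + 1)) +
  (f a (b + 1) (c - 1) + f a (b - 1) (c + 1)) < 16 * f a b c.
Proof.
have f0 : 0 < f a b c := harmonic_bump_gt0 a b c.
have sq (x : R) := sqr_ge0 x.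
have := (sq a, sq b, sq c, sq (a + b + c)) => -[[[sa sb] sc] ss].
have pb x a1 b1 c1 a2 b2 c2 : let r := shifted_form a b c in
    x ^+ 2 <= 2 * (r - form_shift) ->
    shifted_form a1 b1 c1 = r + (2 * x + 2) ->
    shifted_form a2 b2 c2 = r + (- 2 * x + 2) ->
    f a1 b1 c1 + f a2 b2 c2 <=
    f a b c * (2 - 1 / r + 3 / 16 * ((8 * x ^+ 2 + 8) / r ^+ 2)).
  move=> r xr e1 e2; rewrite /f /harmonic_bump e1 e2.
  by apply: pair_bound => //; exact: shifted_form_ge.
have r0 := shifted_form_gt0 a b c.
have rE := formE a b c; move: (shifted_form a b c) => r in rE r0 pb *.
have KE := form_shiftE; have fE := formE.
move: form_shift => K in KE rE fE pb *.
have qE : r - K = a ^+ 2 + b ^+ 2 + c ^+ 2 + (a + b + c) ^+ 2 by rewrite rE;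
  lra.
have h1 : f (a + 1) b c + f (a - 1) b c <= f a b c *
    (2 - 1 / r + 3 / 16 * ((8 * (2 * a + b + c) ^+ 2 + 8) / r ^+ 2)).
  by apply: pb; [have := sq (b + c); rewrite qE; lra|rewrite fE rE; lra|
    rewrite fE rE; lra].
have h2 : f a (b + 1) c + f a (b - 1) c <= f a b c *
    (2 - 1 / r + 3 / 16 * ((8 * (a + 2 * b + c) ^+ 2 + 8) / r ^+ 2)).
  by apply: pb; [have := sq (a + c); rewrite qE; lra|rewrite fE rE; lra|
    rewrite fE rE; lra].
have h3 : f a b (c + 1) + f a b (c - 1) <= f a b c *
    (2 - 1 / r + 3 / 16 * ((8 * (a + b + 2 * c) ^+ 2 + 8) / r ^+ 2)).
  by apply: pb; [have := sq (a + b); rewrite qE; lra|rewrite fE rE; lra|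
    rewrite fE rE; lra].
have h4 : f (a + 1) (b - 1) c + f (a - 1) (b + 1) c <= f a b c *
    (2 - 1 / r + 3 / 16 * ((8 * (a - b) ^+ 2 + 8) / r ^+ 2)).
  by apply: pb; [have := sq (a + b); rewrite qE; lra|rewrite fE rE; lra|
    rewrite fE rE; lra].
have h5 : f (a + 1) b (c - 1) + f (a - 1) b (c + 1) <= f a b c *
    (2 - 1 / r + 3 / 16 * ((8 * (a - c) ^+ 2 + 8) / r ^+ 2)).
  by apply: pb; [have := sq (a + c); rewrite qE; lra|rewrite fE rE; lra|
    rewrite fE rE; lra].
have h6 : f a (b + 1) (c - 1) + f a (b - 1) (c + 1) <= f a b c *
    (2 - 1 / r + 3 / 16 * ((8 * (b - c) ^+ 2 + 8) / r ^+ 2)).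
  by apply: pb; [have := sq (b + c); rewrite qE; lra|rewrite fE rE; lra|
    rewrite fE rE; lra].
have i0 : 0 < r^-1 by rewrite invr_gt0.
have ri : r * r^-1 ^+ 2 = r^-1 by rewrite expr2 mulrA divff ?mul1r// gt_eqF.
have gap : f a b c * (12 - 6 / r + 3 / 16 * ((32 * (r - K) + 48) / r ^+ 2)) =
    f a b c * 12 - (6 * K - 9) * (f a b c * r^-1 ^+ 2).
  rewrite -exprVn (_ : (_ + 48) * _ = 32 * (r * r^-1 ^+ 2) -
    (32 * K - 48) * r^-1 ^+ 2); last by lra.
  by rewrite ri; lra.
have gap0 : 0 < (6 * K - 9) * (f a b c * r^-1 ^+ 2).
  by rewrite mulr_gt0 ?mulr_gt0 ?exprn_gt0// KE; lra.
suff : f a b c * (12 - 6 / r + 3 / 16 * ((32 * (r - K) + 48) / r ^+ 2)) =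
    f a b c * (2 - 1 / r + 3 / 16 * ((8 * (2 * a + b + c) ^+ 2 + 8) / r ^+ 2)) +
    f a b c * (2 - 1 / r + 3 / 16 * ((8 * (a + 2 * b + c) ^+ 2 + 8) / r ^+ 2)) +
    f a b c * (2 - 1 / r + 3 / 16 * ((8 * (a + b + 2 * c) ^+ 2 + 8) / r ^+ 2)) +
    f a b c * (2 - 1 / r + 3 / 16 * ((8 * (a - b) ^+ 2 + 8) / r ^+ 2)) +
    f a b c * (2 - 1 / r + 3 / 16 * ((8 * (a - c) ^+ 2 + 8) / r ^+ 2)) +
    f a b c * (2 - 1 / r + 3 / 16 * ((8 * (b - c) ^+ 2 + 8) / r ^+ 2)).
  have hs := lerD (lerD (lerD (lerD (lerD h1 h2) h3) h4) h5) h6.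
  move=> e; move: hs; rewrite -e gap; move: gap0; clear; lra.
rewrite -!mulrDr; congr (_ * _); rewrite qE.
set i := r^-1; set k := (r ^+ 2)^-1; lra.
Qed.

End Superharmonic.

(** * The walk on the lattice *)

Lemma countable_bigcap_probability1 d (T : measurableType d) (R : realType)
    (P : probability T R) (I : countType) (F : I -> set T) :
  (forall i, measurable (F i)) -> (forall i, P (F i) = 1%E) ->
  P (\bigcap_i F i) = 1%E.
Proof.
move=> mF PF; have mU : measurable (\bigcup_i ~` F i).
  by apply: countable_bigcup_measurable => i _; exact: measurableC.
have -> : \bigcap_i F i = ~` \bigcup_i ~` F i.
  by rewrite setC_bigcup; apply: eq_bigcapr => i _; rewrite setCK.
rewrite probability_setC//.
suff -> : P (\bigcup_i ~` F i) = 0%E by rewrite sube0.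
apply/negligibleP => //.
rewrite (_ : \bigcup_i _ = \bigcup_n oapp (fun i => ~` F i) set0
  (choice.unpickle n)).
  apply: negligible_bigcup => n; case: choice.unpickle => [i|] /=.
    apply/negligibleP; first exact: measurableC.
    by have := probability_setC P (mF i); rewrite PF subee.
  exact: negligible_set0.
apply/seteqP; split=> w [i _ Fw].
  by exists (choice.pickle i); rewrite // choice.pickleK.
by case E : (choice.unpickle i) Fw => [j|//] Fw; exists j.
Qed.

Section Parity.

Definition oddz (z : int) : bool := odd `|z|%N.

Lemma oddzN z : oddz (- z) = oddz z.
Proof. by rewrite /oddz abszN. Qed.

Lemma oddzD x y : oddz (x + y) = oddz x (+) oddz y.
Proof.
have sub (m n : nat) : oddz (m%:Z - n%:Z) = odd m (+) odd n.
  rewrite /oddz; case: (leqP n m) => mn.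
    by rewrite subzn// absz_nat oddB.
  by rewrite -opprB abszN subzn 1?ltnW// absz_nat oddB 1?ltnW// addbC.
case: x => m; case: y => n.
- by rewrite /oddz -PoszD !absz_nat oddD.
- by rewrite NegzE sub oddzN.
- by rewrite NegzE addrC sub oddzN addbC.
- by rewrite !NegzE -opprD !oddzN /oddz -PoszD absz_nat oddD.
Qed.

End Parity.

Section Lattice.
Context (d : nat) (hd : (3 <= d)%N).
Local Notation V := (zd d).

Let lt0 : (0 < d)%N. Proof. exact: leq_trans hd. Qed.
Let lt1 : (1 < d)%N. Proof. exact: leq_trans hd. Qed.
Definition axis0 : 'I_d := Ordinal lt0.
Definition axis1 : 'I_d := Ordinal lt1.
Definition axis2 : 'I_d := Ordinal hd.

(** The labels are chosen to match parities: e_2 changes both bits, so it gets (true, true). A cell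
    becomes a copy of (Z/2)^2, on which adding a bit pair is a swap. *)
Definition corner (b : bool * bool) : V :=
  match b with
  | (false, false) => 0
  | (true, false) => delta_mx 0 axis0
  | (false, true) => delta_mx 0 axis1
  | (true, true) => delta_mx 0 axis2
  end.

Definition xor2 (b c : bool * bool) := (b.1 (+) c.1, b.2 (+) c.2).

Lemma xor2K b c : xor2 (xor2 b c) c = b.
Proof. by rewrite /xor2 /= -!addbA !addbb !addbF; case: b. Qed.

(** A homomorphism onto (Z/2)^2 whose kernel is the body-centred lattice in the three moved
    coordinates, the others being free. The corners represent its four cosets, which is why their
    translates tile. *)
Definition parity (x : V) : bool * bool :=
  (oddz (x 0 axis0 + x 0 axis2), oddz (x 0 axis1 + x 0 axis2)).

Lemma parityD x y : parity (x + y) = xor2 (parity x) (parity y).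
Proof. by rewrite /parity /xor2 /= !mxE -!oddzD; congr (oddz _, oddz _);
  rewrite addrACA. Qed.

Lemma parityN x : parity (- x) = parity x.
Proof. by rewrite /parity !mxE -!opprD !oddzN. Qed.

Lemma parity_corner b : parity (corner b) = b.
Proof. by case: b => [[] []]; rewrite /parity /corner !mxE. Qed.

(* The cells of the two partitions: the translates of the four corners
   (up = true) and of their opposites (up = false). *)
Definition anchor (up : bool) (x : V) : V :=
  if up then x - corner (parity x) else x + corner (parity x).

Definition cell_point (up : bool) (v : V) (b : bool * bool) : V :=
  if up then v + corner b else v - corner b.

Definition swap (up : bool) (c : bool * bool) (x : V) : V :=
  cell_point up (anchor up x) (xor2 (parity x) c).

Lemma anchorK up x : cell_point up (anchor up x) (parity x) = x.
Proof. by case: up; rewrite /cell_point /anchor ?subrK ?addrK. Qed.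

Lemma parity_anchor up x : parity (anchor up x) = (false, false).
Proof.
by case: up; rewrite /anchor parityD ?parityN parity_corner /xor2 !addbb.
Qed.

Lemma parity_cell_point up v b : parity v = (false, false) ->
  parity (cell_point up v b) = b.
Proof.
by case: up => pv; rewrite /cell_point parityD ?parityN parity_corner pv;
  case: b.
Qed.

Lemma anchor_cell_point up v b : parity v = (false, false) ->
  anchor up (cell_point up v b) = v.
Proof.
move=> pv; rewrite /anchor parity_cell_point//.
by case: up; rewrite /cell_point ?addrK ?subrK.
Qed.

Lemma swap_cell_point up c v b : parity v = (false, false) ->
  swap up c (cell_point up v b) = cell_point up v (xor2 b c).
Proof. by move=> pv; rewrite /swap anchor_cell_point// parity_cell_point. Qed.

Lemma anchor_swap up c x : anchor up (swap up c x) = anchor up x.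
Proof. by rewrite /swap anchor_cell_point// parity_anchor. Qed.

Lemma swapK up c : involutive (swap up c).
Proof.
move=> x; rewrite -{1}(anchorK up x) !swap_cell_point ?parity_anchor//.
by rewrite xor2K anchorK.
Qed.

Definition reachable (x w : V) : Prop := exists y z,
  [/\ anchor true y = anchor true x, anchor false z = anchor false y
    & anchor true w = anchor true z].

Definition cell (up : bool) (x : V) : seq V :=
  [seq cell_point up (anchor up x) b |
    b <- [:: (false, false); (true, false); (false, true); (true, true)]].

Lemma mem_cell up x y : anchor up y = anchor up x -> y \in cell up x.
Proof.
move=> yx; rewrite -(anchorK up y) yx /cell map_f//.
by case: (parity y) => [[] []].
Qed.

Definition walk_support (x : V) : seq V :=
  undup (flatten [seq flatten [seq cell true z | z <- cell false y]
    | y <- cell true x]).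

Lemma reachable_support x w : reachable x w -> w \in walk_support x.
Proof.
move=> [y [z [yx zy wz]]]; rewrite mem_undup.
apply/flattenP; exists (flatten [seq cell true z | z <- cell false y]).
  by apply/mapP; exists y => //; exact: mem_cell.
apply/flattenP; exists (cell true z); last exact: mem_cell.
by apply/mapP; exists z => //; exact: mem_cell.
Qed.

Section Distance.
Context (R : realType).

Definition joined (k : nat) (x y : V) : Prop :=
  exists p, [/\ path (@zd_adj d) x p, last x p = y & (size p <= k)%N].

Lemma joined_trans k l x y z : joined k x y -> joined l y z -> joined (k + l) x
  z.
Proof.
move=> [p [px py pk]] [q [qy qz ql]]; exists (p ++ q); split.
- by rewrite cat_path px py.
- by rewrite last_cat py.
- by rewrite size_cat leq_add.
Qed.

Lemma joined_corner x b : joined 1 x (x + corner b) /\ joined 1 x (x - corner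
  b).
Proof.
have adj i (e : int) : `|e| = 1 -> zd_adj x (x + e *: delta_mx 0 i).
  move=> e1; rewrite /zd_adj (bigD1 i)//= big1 ?addr0.
    by rewrite !mxE !eqxx mulr1 opprD addrA subrr sub0r normrN e1.
  move=> j ji; rewrite !mxE (negbTE ji) andbF mulr0 addr0 subrr.
  by rewrite normr0.
have step i (e : int) : `|e| = 1 -> joined 1 x (x + e *: delta_mx 0 i).
  by move=> e1; exists [:: x + e *: delta_mx 0 i]; split; rewrite /= ?adj.
have s1 i : joined 1 x (x + delta_mx 0 i) /\ joined 1 x (x - delta_mx 0 i).
  by split; [have := step i 1; rewrite scale1r|have := step i (- 1);
    rewrite scaleN1r]; exact.
case: b => [[] []]; rewrite /corner ?subr0 ?addr0//; do ?exact: s1.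
by split; exists [::].
Qed.

Lemma joined_cell up x y : anchor up y = anchor up x -> joined 2 x y.
Proof.
move=> yx; apply: (@joined_trans 1 1 _ (anchor up x)).
  by rewrite /anchor; case: up {yx};
    [case: (joined_corner x (parity x))|case: (joined_corner x (parity x))].
rewrite -(anchorK up y) yx /cell_point.
by case: up {yx}; [case: (joined_corner (anchor true x) (parity y))|case:
  (joined_corner (anchor false x) (parity y))].
Qed.

Lemma reachable_dist x w : reachable x w ->
  (graph_dist R (@zd_adj d) x w <= 6%:R%:E)%E.
Proof.
move=> [y [z [/joined_cell xy /joined_cell yz /joined_cell zw]]].
have [p [px pw p6]] := joined_trans xy (joined_trans yz zw).
apply: (@le_trans _ _ (size p)%:R%:E); last by rewrite lee_fin ler_nat.
by apply: ereal_inf_lbound; exists p.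
Qed.

End Distance.

Section Law.
Context (R : realType).

Let law up c : probability (perm_borel V) R := matching_law R (swapK up c).
Let mean up c (h : V -> R) : V -> R := pair_mean (swap up c) h.
Let b1 := (true, false).
Let b2 := (false, true).

Definition sandwich (mu nu : probability (perm_borel V) R) :=
  convolution nu (convolution mu nu).

(* Swapping with the two fair coins b1 and b2 moves a particle to a uniform
   point of its cell; the palindromic order makes the law symmetric. *)
Definition cell_walk_law : probability (perm_borel V) R :=
  sandwich (sandwich (sandwich (law false b2) (law false b1)) (law true b2))
    (law true b1).

Let M : (V -> R) -> V -> R :=
  mean true b1 \o ((mean true b2 \o ((mean false b1 \o
    (mean false b2 \o mean false b1)) \o mean true b2)) \o mean true b1).

Lemma cell_walk_law_symmetric : symmetric_law cell_walk_law.
Proof.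
by do 3! [apply: symmetric_law_sandwich; last exact: matching_law_symmetric];
  exact: matching_law_symmetric.
Qed.

Lemma cell_walk_law_negdep : negdep_mean cell_walk_law M.
Proof.
have nd up c : negdep_mean (law up c) (mean up c).
  move=> h h0; split=> [x|Y uY]; first exact: matching_law_mean.
  exact: matching_law_negdep.
by rewrite /M; do 6! [apply: negdep_mean_convolution => //].
Qed.

(** The probability is the operator [M] applied to the indicator of [B]. Each average stays inside
    one cell, so the value 1 is passed back through all seven averages. *)
Lemma cell_walk_reachable x (B : set V) : (forall w, reachable x w -> B w) ->
  cell_walk_law [set s : perm_borel V | B (s x)] = 1%E.
Proof.
move=> hB; pose h y : R := \1_B y.
have mB : measurable [set s : perm_borel V | B (s x)] by exact:
  measurable_eval_in.
have h0 y : 0 <= h y by rewrite /h indicE.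
transitivity (\int[cell_walk_law]_s (h (s x))%:E)%E.
  by rewrite law_indic//; apply: eq_integral => s _; rewrite /h !indicE.
rewrite (cell_walk_law_negdep h0).1; congr (_%:E).
have mean1 up c g y : (forall z, anchor up z = anchor up y -> g z = 1) ->
    forall z, anchor up z = anchor up y -> mean up c g z = 1.
  move=> g1 z zy; rewrite /mean /pair_mean !g1// ?anchor_swap//.
  by rewrite -mulr2n -[1 *+ 2]/(2%:R) divff.
rewrite /M /=; apply: (mean1 true _ _ x) => //.
apply: (mean1 true _ _ x) => y yx; apply: (mean1 false _ _ y) => //.
apply: (mean1 false _ _ y); apply: (mean1 false _ _ y) => z zy.
apply: (mean1 true _ _ z) => //; apply: (mean1 true _ _ z) => w wz.
by rewrite /h indicE mem_set//; apply: hB; exists y, z.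
Qed.

Lemma cell_walk_range (r : R) : 6%:R <= r ->
  cell_walk_law (range_le (@zd_adj d) r) = 1%E.
Proof.
move=> r6; rewrite (_ : range_le _ r = \bigcap_x [set s : perm_borel V |
    (graph_dist R (@zd_adj d) x (s x) <= r%:E)%E]).
  apply: countable_bigcap_probability1 => x.
    exact: (measurable_eval_in x [set y | (graph_dist R (@zd_adj d) x y <=
      r%:E)%E]).
  apply: (@cell_walk_reachable x
    [set y | (graph_dist R (@zd_adj d) x y <= r%:E)%E]) => w xw.
  by apply: le_trans (reachable_dist R xw) _; rewrite lee_fin.
apply/seteqP; split=> s /=.
  move=> h x _; apply: le_trans h; apply: ereal_sup_ubound; exists x => //.
by move=> h; apply: ge_ereal_sup => _ [x _ <-]; exact: h.
Qed.

(** The anchor moves by 2 (t_i - t_j); halving turns these into the steps of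
    [harmonic_bump_mean]. *)
Let half_coord (v : V) i : R := (v 0 i)%:~R / 2.
Definition bump (x : V) : R := let v := anchor true x in
  harmonic_bump (half_coord v axis0) (half_coord v axis1) (half_coord v axis2).

Lemma bump_gt0 x : 0 < bump x.
Proof. exact: harmonic_bump_gt0. Qed.

(** [bump] depends on the up-cell only, so the up-swaps that close the walk leave it fixed. *)
Let mean_up c : mean true c bump = bump.
Proof.
apply/funext => x; rewrite /mean /pair_mean /bump anchor_swap; lra.
Qed.

Let cell_mean up (g : V -> R) v : R :=
  (g (cell_point up v (false, false)) + g (cell_point up v (true, false)) +
   g (cell_point up v (false, true)) + g (cell_point up v (true, true))) / 4.

Let mean_cell_point up c g v b : parity v = (false, false) ->
  mean up c g (cell_point up v b) =
  (g (cell_point up v b) + g (cell_point up v (xor2 b c))) / 2.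
Proof. by move=> pv; rewrite /mean /pair_mean swap_cell_point. Qed.

Let mean_up2 g v b : parity v = (false, false) ->
  mean true b1 (mean true b2 g) (cell_point true v b) = cell_mean true g v.
Proof.
move=> pv; rewrite !mean_cell_point// /cell_mean /b1 /b2 /xor2.
by case: b => [[] []] /=; lra.
Qed.

(** Two averages already make the position uniform in the cell; the second b1, present for the
    palindrome, preserves this. *)
Let mean_down3 g v b : parity v = (false, false) ->
  mean false b1 (mean false b2 (mean false b1 g)) (cell_point false v b) =
  cell_mean false g v.
Proof.
move=> pv; rewrite !mean_cell_point// /cell_mean /b1 /b2 /xor2.
by case: b => [[] []] /=; lra.
Qed.

Let parity_double x : parity (x + x) = (false, false).
Proof. by rewrite parityD /xor2 !addbb. Qed.

Lemma bump_mean x : M bump x < bump x.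
Proof.
rewrite /M /= !mean_up -{1}(anchorK true x).
set v := anchor true x;
  have pv : parity v = (false, false) by exact: parity_anchor.
rewrite mean_up2// /cell_mean.
(* The site v + t_b of the up-cell lies in the down-cell anchored at v + 2 t_b; moving inside it to
   v + 2 t_b - t_b' gives the new up-anchor v + 2 t_b - 2 t_b'. *)
pose u b := v + (corner b + corner b).
have pu b : parity (u b) = (false, false).
  by rewrite parityD pv parity_double.
have upE b : cell_point true v b = cell_point false (u b) b.
  by rewrite /cell_point /u addrA addrK.
rewrite !upE !mean_down3// /cell_mean.
have bumpE b b' : bump (cell_point false (u b) b') = harmonic_bump
    (half_coord v axis0 + (corner b 0 axis0)%:~R - (corner b' 0 axis0)%:~R)
    (half_coord v axis1 + (corner b 0 axis1)%:~R - (corner b' 0 axis1)%:~R)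
    (half_coord v axis2 + (corner b 0 axis2)%:~R - (corner b' 0 axis2)%:~R).
  have aE : anchor true (cell_point false (u b) b') =
      v + (corner b + corner b) - (corner b' + corner b').
    by rewrite /anchor parity_cell_point// /cell_point /u -[LHS]addrA -opprD.
  have hE i : half_coord (anchor true (cell_point false (u b) b')) i =
      half_coord v i + (corner b 0 i)%:~R - (corner b' 0 i)%:~R.
    rewrite aE /half_coord !mxE !(intrD, intrN); lra.
  by rewrite /bump !hE.
rewrite !bumpE /= !mxE /= ?subr0 ?addr0 ?addrK ?mulr1z.
have := harmonic_bump_mean (half_coord v axis0) (half_coord v axis1)
  (half_coord v axis2).
rewrite -[bump x]/(harmonic_bump (half_coord v axis0) (half_coord v axis1)
  (half_coord v axis2)).
cbv zeta; lra.
Qed.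

Let p : V -> V -> R := site_transition cell_walk_law.

Lemma cell_walk_support x :
  cell_walk_law [set s : perm_borel V | s x \in walk_support x] = 1%E.
Proof.
apply: (@cell_walk_reachable x [set w | w \in walk_support x]) => w.
exact: reachable_support.
Qed.

Let step_meanE h x : (forall y, 0 <= h y) ->
  step_mean p walk_support h x = M h x.
Proof.
move=> h0; apply: EFin_inj; rewrite -(cell_walk_law_negdep h0).1.
rewrite -(integral_act (@measurable_eval V) _ cell_walk_support)// => y.
exact: undup_uniq.
Qed.

Lemma cell_walk_negdep (h : V -> R) : (forall x, 0 <= h x) ->
  forall Y, uniq Y -> (\int[cell_walk_law]_s (\prod_(x <- Y) h (s x))%:E <=
    (\prod_(x <- Y) step_mean p walk_support h x)%:E)%E.
Proof.
move=> h0 Y uY; rewrite (eq_bigr _ (fun x _ => step_meanE x h0)).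
exact: (cell_walk_law_negdep h0).2.
Qed.

Lemma cell_walk_transient : transient p.
Proof.
apply: (@superharmonic_transient R V p walk_support _ _ _ bump).
- by move=> x y; exact: map_transition_ge0.
- by move=> x; exact: undup_uniq.
- by move=> x; apply: site_transition_sum1 => [y|];
  [exact: undup_uniq|exact: cell_walk_support].
- exact: bump_gt0.
- by move=> x; rewrite step_meanE ?bump_mean// => y; exact/ltW/bump_gt0.
Qed.

End Law.

End Lattice.

Theorem theorem1p13 (R : realType) (d : nat) (r : int)
    (hd : (3 <= d)%N) (hr : Num.ceil (3 * Num.sqrt (d%:R : R)) <= r) :
  exists mu : probability (perm_borel (zd d)) R,
    [/\ mu (range_le (@zd_adj d) (r%:~R : R)) = 1%E,
        symmetric_law mu,
        transient (conductance_transition mu)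
      & forall (dO : measure_display) (Om : measurableType dO)
          (P : probability Om R) (s : nat -> {mfun Om >-> perm_borel (zd d)}),
          iid_law P mu s ->
          markov_chain (conductance_transition mu) (0 : zd d) P
            (fun n w => walk (fun i => s i w) n (0 : zd d))
          /\
          let pT := fine (P [set w |
            return_time R (0 : zd d) (fun i => s i w) = +oo%E]) in
          let E n := 'E_P[(fun w => (2^-1 : R) ^+
            #|` fset_set (inverted_orbit (0 : zd d) (fun i => s i w) n)|)%R]%E
              in
          (exists eps : nat -> R,
             eps =o_\oo (fun n => n%:R : R) /\
             forall n, ((expR (- (n%:R * ln 2 * pT) + eps n))%:E <= E n)%E) /\
          (forall n, (E n <= (expR (- (n.+1%:R / 2 * pT)))%:E)%E)].
Proof.
pose mu := cell_walk_law hd R; pose supp := walk_support hd.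
have smu : symmetric_law mu by exact: cell_walk_law_symmetric.
have usupp x : uniq (supp x) by exact: undup_uniq.
have musupp x : mu [set s : perm_borel (zd d) | s x \in supp x] = 1%E.
  exact: cell_walk_support.
have nd := @cell_walk_negdep d hd R.
have pE : conductance_transition mu = site_transition mu.
  apply/funext => x; apply/funext => y.
  exact: (conductance_transitionE smu usupp musupp).
exists mu; rewrite pE; split => //.
- apply: cell_walk_range.
  (* (5/3)^2 = 25/9 < 3, so 3 sqrt d > 5, and an integer above 5 is at least 6, the range bound of
     the walk. *)
  have s53 : 5 / 3 < Num.sqrt (d%:R : R).
    apply: (@lt_le_trans _ _ (Num.sqrt (3%:R : R)));
      last by rewrite ler_wsqrtr// ler_nat.
    rewrite -(@ltr_pXn2r _ 2)// ?nnegrE ?sqrtr_ge0 ?divr_ge0// sqr_sqrtr//.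
    by rewrite expr2; lra.
  have : (5%:~R : R) < r%:~R.
    apply: (@lt_le_trans _ _ (3 * Num.sqrt (d%:R : R))); first by lra.
    by rewrite -ceil_le_int.
  rewrite ltr_int -lezD1 -(ler_int R) => h.
  by apply: le_trans h.
- exact: cell_walk_transient.
move=> dO Om P s iid; split; first exact: (walk_markov_chain _ iid).
have EE (X : Om -> R) : ('E_P[X] = \int[P]_w (X w)%:E)%E by rewrite unlock.
cbv zeta; split.
  (* The witness for [eps] is read off from the lower bound: it is what must be added to -n log 2 pT
     to get -log 2 times the sum of escape probabilities. *)
  eexists; split; first exact: (orbit_error_littleo 0 usupp musupp iid).
  move=> n; rewrite EE;
    apply: le_trans (orbit_lower_bound 0 usupp musupp iid n).
  by rewrite lee_fin ler_expR; lra.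
by move=> n; rewrite EE; exact: (orbit_upper_bound 0 smu usupp musupp nd iid).
Qed.
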